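(* Let $R$ be a countable Borel probability-measure-preserving equivalence relation on a standard probability space $(X,\mu)$. Let $G$ be a countable group acting on $(X,\mu)$ by measure-preserving Borel automorphisms and inducing $R$, i.e. $R=\{(x,gx):x\in X,\ g\in G\}$. The following are equivalent: (1) $R$ is sofic; (2) there exist a free ultrafilter $\mathcal{U}$ on $\mathbb{N}$, a sequence $(n_k)$ of positive integers, and isometric embeddings $\theta:[R]\to\prod_{\mathcal{U}}\mathfrak{S}_{n_k}$ and $\phi:\operatorname{MAlg}(X,\mu)\to\prod_{\mathcal{U}}\operatorname{MAlg}(n_k)$ which form a covariant pair; (3) there exist a free ultrafilter $\mathcal{U}$ on $\mathbb{N}$, a sequence $(n_k)$ of positive integers, a trace-preserving homomorphism $\theta:G\to\prod_{\mathcal{U}}\mathfrak{S}_{n_k}$ and an isometric embedding $\phi:\operatorname{MAlg}(X,\mu)\to\prod_{\mathcal{U}}\operatorname{MAlg}(n_k)$ which form a covariant pair. Moreover, if $G$ acts freely ($\mu$-a.e.) on $X$, then the requirement in (3) that $\theta$ be trace-preserving may be dropped (i.e. (1)-(3) are also equivalent to the condition obtained from (3) by requiring only that $\theta$ be a group homomorphism).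
   Context: Relations and full semigroups. A standard probability space $(X,\mu)$ is a standard Borel space with a Borel probability measure. A countable Borel equivalence relation $R$ on $X$ is an equivalence relation that is Borel in $X\times X$ with all classes $R(x)$ countable. $[[R]]_B$ is the set of Borel isomorphisms $g:\operatorname{dom}g\to\operatorname{ran}g$ between Borel subsets of $X$ with $(x,gx)\in R$ for all $x\in\operatorname{dom}g$; it is an inverse monoid under composition of partial maps. $R$ is measure-preserving if $\mu(g(A))=\mu(A)$ for all $g\in[[R]]_B$ and Borel $A\subseteq\operatorname{dom}g$. The full semigroup $[[R]]$ is the quotient of $[[R]]_B$ by the pseudometric $d_\mu(g,h)=\mu(\operatorname{dom}g\triangle\operatorname{dom}h)+\mu\{x\in\operatorname{dom}g\cap\operatorname{dom}h:gx\ne hx\}$. The full group $[R]$ is the image in $[[R]]$ of those $g$ with $\operatorname{dom}g=\operatorname{ran}g=X$. The trace is $\operatorname{tr}(g)=\mu\{x\in\operatorname{dom}g:gx=x\}$; each element of $G$ has the trace $\operatorname{tr}(g)=\mu\{x:gx=x\}$. $\operatorname{MAlg}(X,\mu)$ is the set of Borel subsets of $X$ modulo null sets, an inverse monoid under intersection, with metric $\mu(A\triangle B)$. Finite case. $[n]=\{0,\dots,n-1\}$ with normalized counting measure $\mu_\#(A)=\#A/n$; $[[n]]$ is the set of all partial bijections of $[n]$, $\mathfrak{S}_n$ the permutation group of $[n]$, $\operatorname{MAlg}(n)$ the set of subsets of $[n]$. The metric on $[[n]]$, and on $\mathfrak{S}_n\subseteq[[n]]$, is $d_\#(g,h)=\mu_\#(\operatorname{dom}g\triangle\operatorname{dom}h)+\mu_\#\{i\in\operatorname{dom}g\cap\operatorname{dom}h:g(i)\ne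 h(i)\}$; the trace of $g\in[[n]]$ is $\operatorname{tr}(g)=\mu_\#\{i\in\operatorname{dom}g:g(i)=i\}$; the metric on $\operatorname{MAlg}(n)$ is $\mu_\#(A\triangle B)$. Ultraproducts. For metric spaces $(M_k,d_k)$ of diameter $\le 1$ and a free ultrafilter $\mathcal{U}$ on $\mathbb{N}$, $\prod_{\mathcal{U}}M_k$ is the metric quotient of $\prod_kM_k$ under $d_{\mathcal{U}}((x_k),(y_k))=\lim_{k\to\mathcal{U}}d_k(x_k,y_k)$; the class of $(x_k)$ is $(x_k)_{\mathcal{U}}$. Operations are coordinatewise, $\operatorname{tr}(g_k)_{\mathcal{U}}=\lim_{k\to\mathcal{U}}\operatorname{tr}(g_k)$, and $\prod_{\mathcal{U}}\mathfrak{S}_{n_k}$ acts on $\prod_{\mathcal{U}}\operatorname{MAlg}(n_k)$ by $(\sigma_k)_{\mathcal{U}}\cdot(A_k)_{\mathcal{U}}=(\sigma_k(A_k))_{\mathcal{U}}$. Embeddings are injective maps preserving the algebraic structure (products of groups, intersections in measure algebras). Covariance. If groups $G,H$ act on sets $X,Y$, a pair $(\theta,\phi)$ with $\theta:G\to H$ a homomorphism and $\phi:X\to Y$ a function is covariant if $\phi(g(x))=\theta(g)(\phi(x))$ for all $g\in G$, $x\in X$. Here $[R]$ and $G$ act on $\operatorname{MAlg}(X,\mu)$ by $A\mapsto g(A)$. Sofic. $R$ is sofic if for each finite $K\subseteq[[R]]$ and $\epsilon>0$ there exist $N\in\mathbb{N}$ and $\pi:[[R]]\to[[N]]$ with: (i)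 $\pi(\operatorname{id}_X)=1_{[N]}$ and $\pi(\varnothing)=\varnothing$; (ii) $d_\#(\pi(\varphi\psi),\pi(\varphi)\pi(\psi))<\epsilon$ for all $\varphi,\psi\in K$; (iii) $|\operatorname{tr}(\varphi)-\operatorname{tr}(\pi(\varphi))|<\epsilon$ for all $\varphi\in K$. *)

(* Defs.v *)
From HB Require Import structures.
From mathcomp Require Import all_boot all_order all_algebra.
From mathcomp Require Import perm.
From mathcomp Require Import all_classical all_reals all_analysis.

Set Implicit Arguments.
Unset Strict Implicit.
Unset Printing Implicit Defensive.

Import Order.TTheory GRing.Theory Num.Theory.
Import numFieldNormedType.Exports.

Local Open Scope classical_set_scope.
Local Open Scope ring_scope.

(* [X] carries, up to a bijection [f], the Borel sigma-algebra of a Polish    *)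
(* space; a Hausdorff pseudometric space is a metric space.                   *)
Definition standard_borel (R : realType) d (X : measurableType d) : Prop :=
  exists (P : completePseudoMetricType R) (f : X -> P),
    [/\ hausdorff_space P,
        exists2 D : set P, countable D & dense D,
        bijective f
      & forall A : set X, measurable A <-> <<s [set B : set P | open B] >> (f @` A)].

Definition free_ultrafilter (U : set_system nat) : Prop :=
  UltraFilter U /\ forall n, ~ U [set n].

(* The quotient of [T] identifying points at distance 0, for a pseudometric    *)
(* [dist].  Distances and operations are computed on representatives; all those *)
(* used below are compatible with the relation [dist x y = 0], so the choice of *)
(* representatives is immaterial.                                              *)
Section MetricQuotient.
Variable R : realType.

Definition mquot (T : Type) (dist : T -> T -> R) : Type :=
  {C : set T | exists x, C = [set y | dist x y = 0]}.

Definition mcls (T : Type) (dist : T -> T -> R) (x : T) : mquot dist :=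
  exist _ [set y | dist x y = 0] (ex_intro _ x erefl).

Definition mrepr (T : Type) (dist : T -> T -> R) (q : mquot dist) : T :=
  sval (cid (proj2_sig q)).

Lemma mreprK (T : Type) (dist : T -> T -> R) : cancel (@mrepr T dist) (mcls dist).
Proof.
case=> C hC; rewrite /mcls /mrepr /=; case: cid => x /= ex.
by apply: eq_exist; rewrite -ex.
Qed.

Lemma mcls_eq (T : Type) (dist : T -> T -> R) :
    (forall x, dist x x = 0) -> (forall x y, dist x y = dist y x) ->
    (forall x y, 0 <= dist x y) ->
    (forall x y z, dist x z <= dist x y + dist y z) ->
  forall x y, mcls dist x = mcls dist y <-> dist x y = 0.
Proof.
move=> d0 dC dp dT x y; split.
  by move=> /(congr1 sval)/= /(congr1 (@^~ y))/= ->.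
move=> xy0; apply: eq_exist; apply/seteqP; split=> z /= h;
  apply/eqP; rewrite eq_le dp andbT.
  by rewrite (le_trans (dT _ x _))// h dC xy0 addr0.
by rewrite (le_trans (dT _ y _))// h xy0 addr0.
Qed.

Definition mdist (T : Type) (dist : T -> T -> R) (p q : mquot dist) : R :=
  dist (mrepr p) (mrepr q).

Definition mmap2 (T1 T2 T3 : Type) (d1 : T1 -> T1 -> R) (d2 : T2 -> T2 -> R)
    (d3 : T3 -> T3 -> R) (op : T1 -> T2 -> T3)
    (p : mquot d1) (q : mquot d2) : mquot d3 :=
  mcls d3 (op (mrepr p) (mrepr q)).

Definition uprod (U : set_system nat) (M : nat -> Type)
    (dist : forall k, M k -> M k -> R) : Type :=
  mquot (fun x y : forall k, M k => lim ((fun k => dist k (x k) (y k)) @ U)).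

End MetricQuotient.

(* Partial maps are option-valued functions, composed with [pcomp]. *)
Section PartialMaps.
Variables S T : Type.
Implicit Type f : S -> option T.

Definition pinjective f : Prop :=
  forall x y z, f x = Some z -> f y = Some z -> x = y.
Definition pdom f : set S := [set x | isSome (f x)].
Definition pran f : set T := [set y | exists x, f x = Some y].
Definition pimage f (A : set S) : set T := [set y | exists2 x, A x & f x = Some y].
Definition ppreimage f (B : set T) : set S := [set x | exists2 y, B y & f x = Some y].

End PartialMaps.

Lemma pcomp_pinjective (S T V : Type) (g : T -> option V) (f : S -> option T) :
  pinjective g -> pinjective f -> pinjective (pcomp g f).
Proof.
move=> gi fi x y z; rewrite /pcomp.
case fx: (f x) => [a|]//=; case fy: (f y) => [b|]//= ga gb.
by apply: (fi _ _ a) => //; rewrite fy (gi _ _ _ gb ga).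
Qed.

Lemma pimage_pcomp (S T V : Type) (g : T -> option V) (f : S -> option T) A :
  pimage (pcomp g f) A = pimage g (pimage f A).
Proof.
apply/seteqP; split=> z /=; rewrite /pimage /pcomp /=.
  by case=> x Ax; case fx: (f x) => [y|]//= gy; exists y => //; exists x.
by case=> y [x Ax fx] gy; exists x => //; rewrite fx.
Qed.

Lemma ppreimage_pcomp (S T V : Type) (g : T -> option V) (f : S -> option T) B :
  ppreimage (pcomp g f) B = ppreimage f (ppreimage g B).
Proof.
apply/seteqP; split=> x /=; rewrite /ppreimage /pcomp /=.
  by case=> z Bz; case fx: (f x) => [y|]//= gy; exists y => //; exists z.
by case=> y [z Bz gy] fx; exists z => //; rewrite fx.
Qed.

Record cber d (X : measurableType d) := Cber {
  cber_rel :> X -> X -> Prop;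
  cber_refl : forall x, cber_rel x x;
  cber_sym : forall x y, cber_rel x y -> cber_rel y x;
  cber_trans : forall x y z, cber_rel x y -> cber_rel y z -> cber_rel x z;
  cber_borel : measurable [set p : X * X | cber_rel p.1 p.2];
  cber_countable : forall x, countable [set y | cber_rel x y]
}.

(* [[E]]_B: a Borel isomorphism between Borel subsets is an injective partial *)
(* map whose preimages (hence domain) and images (hence range) of Borel sets  *)
(* are Borel.                                                                 *)
Record fsgB d (X : measurableType d) (E : cber X) := FsgB {
  fsgB_fun :> X -> option X;
  fsgB_inj : pinjective fsgB_fun;
  fsgB_preimage : forall B, measurable B -> measurable (ppreimage fsgB_fun B);
  fsgB_image : forall A, measurable A -> measurable (pimage fsgB_fun A);
  fsgB_rel : forall x y, fsgB_fun x = Some y -> E x y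
}.

Section FullSemigroupB.
Variables (d : measure_display) (X : measurableType d) (E : cber X).

Lemma pimage_Some A : pimage (@Some X) A = A.
Proof. by apply/seteqP; split=> [y [x Ax [<-]]//|y Ay]; exists y. Qed.

Lemma ppreimage_Some B : ppreimage (@Some X) B = B.
Proof. by apply/seteqP; split=> [x [y By [->]]//|x Bx]; exists x. Qed.

Lemma Some_pinjective : pinjective (@Some X).
Proof. by move=> x y z [->] [->]. Qed.

Lemma Some_preimage (B : set X) : measurable B -> measurable (ppreimage (@Some X) B).
Proof. by rewrite ppreimage_Some. Qed.

Lemma Some_image (A : set X) : measurable A -> measurable (pimage (@Some X) A).
Proof. by rewrite pimage_Some. Qed.

Lemma Some_rel x y : Some x = Some y -> E x y.
Proof. by case=> <-; exact: cber_refl. Qed.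

Definition fsgB_id : fsgB E :=
  FsgB Some_pinjective Some_preimage Some_image Some_rel.

Let pempty (x : X) : option X := None.

Lemma pempty_pinjective : pinjective pempty.
Proof. by []. Qed.

Lemma pempty_preimage (B : set X) : measurable B -> measurable (ppreimage pempty B).
Proof.
by rewrite (_ : ppreimage _ _ = set0)//; apply/seteqP; split=> x // -[].
Qed.

Lemma pempty_image (A : set X) : measurable A -> measurable (pimage pempty A).
Proof.
by rewrite (_ : pimage _ _ = set0)//; apply/seteqP; split=> x // -[].
Qed.

Lemma pempty_rel x y : pempty x = Some y -> E x y.
Proof. by []. Qed.

Definition fsgB_empty : fsgB E :=
  FsgB pempty_pinjective pempty_preimage pempty_image pempty_rel.

Section Mul.
Variables g h : fsgB E.

Lemma fsgB_mul_inj : pinjective (pcomp g h).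
Proof. by apply: pcomp_pinjective; apply: fsgB_inj. Qed.

Lemma fsgB_mul_preimage B : measurable B -> measurable (ppreimage (pcomp g h) B).
Proof. by move=> mB; rewrite ppreimage_pcomp; do 2 apply: fsgB_preimage. Qed.

Lemma fsgB_mul_image A : measurable A -> measurable (pimage (pcomp g h) A).
Proof. by move=> mA; rewrite pimage_pcomp; do 2 apply: fsgB_image. Qed.

Lemma fsgB_mul_rel x y : pcomp g h x = Some y -> E x y.
Proof.
rewrite /pcomp; case hx: (h x) => [z|]//= gz.
exact: cber_trans (fsgB_rel hx) (fsgB_rel gz).
Qed.

Definition fsgB_mul : fsgB E :=
  FsgB fsgB_mul_inj fsgB_mul_preimage fsgB_mul_image fsgB_mul_rel.

End Mul.

Definition fsgB_total (g : fsgB E) : Prop := pdom g = setT /\ pran g = setT.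

Lemma fsgB_total_mul (g h : fsgB E) :
  fsgB_total g -> fsgB_total h -> fsgB_total (fsgB_mul g h).
Proof.
move=> [dg rg] [dh rh]; split; apply/seteqP; split=> x // _.
  have : pdom h x by rewrite dh.
  rewrite /pdom /= /pcomp; case: (h x) => [y|]//= _.
  by have : pdom g y by rewrite dg.
have [y gy] : pran g x by rewrite rg.
have [z hz] : pran h y by rewrite rh.
by exists z; rewrite /= /pcomp hz.
Qed.

End FullSemigroupB.

Section MeasuredRelation.
Variables (R : realType) (d : measure_display) (X : measurableType d).
Variables (mu : probability X R).

Definition borel_set : Type := {A : set X | measurable A}.

Definition dMAlg (A B : borel_set) : R := fine (mu (sval A `+` sval B)).

Definition MAlg : Type := mquot dMAlg.

Definition borel_setI (A B : borel_set) : borel_set :=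
  exist _ (sval A `&` sval B) (measurableI _ _ (svalP A) (svalP B)).

Definition MAlg_cap : MAlg -> MAlg -> MAlg := mmap2 _ borel_setI.

Variable E : cber X.

Definition measure_preserving : Prop :=
  forall (g : fsgB E) (A : set X), measurable A -> A `<=` pdom g ->
    mu (pimage g A) = mu A.

Definition dmu (g h : fsgB E) : R :=
  fine (mu (pdom g `+` pdom h))
  + fine (mu [set x | [/\ pdom g x, pdom h x & g x <> h x]]).

Definition full_semigroup : Type := mquot dmu.

Definition fsg_id : full_semigroup := mcls dmu (fsgB_id E).
Definition fsg_empty : full_semigroup := mcls dmu (fsgB_empty E).
Definition fsg_mul : full_semigroup -> full_semigroup -> full_semigroup :=
  mmap2 _ (@fsgB_mul d X E).
Definition fsg_tr (g : full_semigroup) : R :=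
  fine (mu [set x | mrepr g x = Some x]).

Definition full_group : Type :=
  {g : full_semigroup | exists2 h : fsgB E, fsgB_total h & g = mcls dmu h}.

Definition fg_repr (g : full_group) : fsgB E := s2val (cid2 (svalP g)).

Lemma fg_repr_total (g : full_group) : fsgB_total (fg_repr g).
Proof. by rewrite /fg_repr; case: cid2. Qed.

Lemma fg_reprK (g : full_group) : mcls dmu (fg_repr g) = sval g.
Proof. by rewrite /fg_repr; case: cid2. Qed.

Definition fg_mul (g h : full_group) : full_group :=
  exist _ (mcls dmu (fsgB_mul (fg_repr g) (fg_repr h)))
    (ex_intro2 _ _ _ (fsgB_total_mul (fg_repr_total g) (fg_repr_total h)) erefl).

Definition fg_dist (g h : full_group) : R := mdist (sval g) (sval h).

Definition fsgB_act (g : fsgB E) (A : borel_set) : borel_set :=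
  exist _ (pimage g (sval A)) (fsgB_image g (svalP A)).

Definition fg_act (g : full_group) (A : MAlg) : MAlg :=
  mcls dMAlg (fsgB_act (fg_repr g) (mrepr A)).

End MeasuredRelation.

Record pmp_action (R : realType) (G : groupType) d (X : measurableType d)
    (mu : probability X R) := PmpAction {
  pact :> G -> X -> X;
  pact1 : forall x, pact 1%g x = x;
  pactM : forall g h x, pact (g * h)%g x = pact g (pact h x);
  pact_borel : forall g, measurable_fun setT (pact g);
  pact_pres : forall g (A : set X), measurable A -> mu (pact g @` A) = mu A
}.

Section Actions.
Variables (R : realType) (G : groupType) (d : measure_display).
Variables (X : measurableType d) (mu : probability X R) (a : pmp_action G mu).

Lemma measurable_pact_image g (A : set X) : measurable A -> measurable (a g @` A).
Proof.
move=> mA; rewrite (_ : a g @` A = setT `&` a g^-1%g @^-1` A).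
  exact: (pact_borel a g^-1%g).
rewrite setTI; apply/seteqP; split=> [_ [x Ax <-]|x /= Ax] /=.
  by rewrite -pactM mulVg pact1.
by exists (a g^-1%g x) => //; rewrite -pactM mulgV pact1.
Qed.

Definition pact_set (g : G) (A : borel_set X) : borel_set X :=
  exist _ (a g @` sval A) (measurable_pact_image g (svalP A)).

Definition pact_MAlg (g : G) (A : MAlg mu) : MAlg mu :=
  mcls (dMAlg mu) (pact_set g (mrepr A)).

Definition pact_tr (g : G) : R := fine (mu [set x | a g x = x]).

Definition pact_induces (E : cber X) : Prop :=
  forall x y, E x y <-> exists g, y = a g x.

Definition pact_free : Prop :=
  {ae mu, forall x, forall g, a g x = x -> g = 1%g}.

End Actions.

(* Partial bijections of {0, .., n-1}. *)
Record fsgn (n : nat) := Fsgn {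
  fsgn_fun :> {ffun 'I_n -> option 'I_n};
  fsgn_inj : pinjective fsgn_fun
}.

Section Finite.
Variables (R : realType) (n : nat).

Definition mu_count (A : {set 'I_n}) : R := #|A|%:R / n%:R.

Definition dMAlgn (A B : {set 'I_n}) : R :=
  mu_count ((A :\: B) :|: (B :\: A))%SET.

Definition fsgn_dom (g : fsgn n) : {set 'I_n} := [set i | isSome (g i)]%SET.

Definition dcount (g h : fsgn n) : R :=
  dMAlgn (fsgn_dom g) (fsgn_dom h)
  + mu_count [set i in (fsgn_dom g :&: fsgn_dom h)%SET | g i != h i]%SET.

Definition fsgn_tr (g : fsgn n) : R := mu_count [set i | g i == Some i]%SET.

Lemma fsgn_mul_inj (g h : fsgn n) :
  pinjective ([ffun i => pcomp g h i] : {ffun 'I_n -> option 'I_n}).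
Proof.
move=> x y z; rewrite !ffunE; apply: pcomp_pinjective; exact: fsgn_inj.
Qed.

Definition fsgn_mul (g h : fsgn n) : fsgn n := Fsgn (@fsgn_mul_inj g h).

Lemma fsgn_perm_inj (s : 'S_n) :
  pinjective ([ffun i => Some (s i)] : {ffun 'I_n -> option 'I_n}).
Proof. by move=> x y z; rewrite !ffunE => -[<-] [/perm_inj]. Qed.

Definition fsgn_perm (s : 'S_n) : fsgn n := Fsgn (@fsgn_perm_inj s).

Definition fsgn_id : fsgn n := fsgn_perm 1%g.

Lemma fsgn_empty_inj :
  pinjective ([ffun=> None] : {ffun 'I_n -> option 'I_n}).
Proof. by move=> x y z; rewrite !ffunE. Qed.

Definition fsgn_empty : fsgn n := Fsgn fsgn_empty_inj.

Definition dperm (s t : 'S_n) : R := dcount (fsgn_perm s) (fsgn_perm t).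

Definition perm_tr (s : 'S_n) : R := fsgn_tr (fsgn_perm s).

(* The library's [s * t] applies [s] first, whence the order of the factors. *)
Definition perm_comp (s t : 'S_n) : 'S_n := (t * s)%g.

End Finite.

Section Ultraproducts.
Variables (R : realType) (U : set_system nat) (n : nat -> nat).

Definition uperm : Type := uprod U (fun k => @dperm R (n k)).
Definition uMAlg : Type := uprod U (fun k => @dMAlgn R (n k)).

Definition uperm_mul : uperm -> uperm -> uperm :=
  mmap2 _ (fun (s t : forall k, 'S_(n k)) k => perm_comp (s k) (t k)).

Definition uMAlg_cap : uMAlg -> uMAlg -> uMAlg :=
  mmap2 _ (fun (A B : forall k, {set 'I_(n k)}) k => (A k :&: B k)%SET).

Definition uperm_act : uperm -> uMAlg -> uMAlg :=
  mmap2 _ (fun (s : forall k, 'S_(n k)) (A : forall k, {set 'I_(n k)}) k =>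
    (s k @: A k)%SET).

Definition uperm_tr (s : uperm) : R := lim ((fun k => perm_tr R (mrepr s k)) @ U).

End Ultraproducts.

Definition isometric (R : realType) (S T : Type) (dS : S -> S -> R)
    (dT : T -> T -> R) (f : S -> T) : Prop :=
  forall x y, dT (f x) (f y) = dS x y.

Definition preserves (S T : Type) (mS : S -> S -> S) (mT : T -> T -> T)
    (f : S -> T) : Prop :=
  forall x y, f (mS x y) = mT (f x) (f y).

Definition isometric_embedding (R : realType) (S T : Type)
    (mS : S -> S -> S) (dS : S -> S -> R) (mT : T -> T -> T) (dT : T -> T -> R)
    (f : S -> T) : Prop :=
  [/\ injective f, preserves mS mT f & isometric dS dT f].

Definition covariant (G H S T : Type) (aS : G -> S -> S) (aT : H -> T -> T)
    (theta : G -> H) (phi : S -> T) : Prop :=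
  forall g x, phi (aS g x) = aT (theta g) (phi x).

Section Embeddings.
Variables (R : realType) (d : measure_display) (X : measurableType d).
Variables (mu : probability X R) (U : set_system nat) (n : nat -> nat).

Definition MAlg_embedding (phi : MAlg mu -> uMAlg R U n) : Prop :=
  isometric_embedding (@MAlg_cap R d X mu) (@mdist R _ _)
    (@uMAlg_cap R U n) (@mdist R _ _) phi.

Definition full_group_embedding (E : cber X)
    (theta : full_group mu E -> uperm R U n) : Prop :=
  isometric_embedding (@fg_mul R d X mu E) (@fg_dist R d X mu E)
    (@uperm_mul R U n) (@mdist R _ _) theta.

Definition uperm_hom (G : groupType) (theta : G -> uperm R U n) : Prop :=
  preserves (fun g h : G => (g * h)%g) (@uperm_mul R U n) theta.

End Embeddings.

(* [0 < N] because the normalized counting measure is undefined on [0]. *)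
Definition sofic (R : realType) d (X : measurableType d) (mu : probability X R)
    (E : cber X) : Prop :=
  forall (K : set (full_semigroup mu E)) (e : R), finite_set K -> 0 < e ->
  exists (N : nat) (pi : full_semigroup mu E -> fsgn N),
    [/\ (0 < N)%N,
        pi (fsg_id mu E) = fsgn_id N /\ pi (fsg_empty mu E) = fsgn_empty N,
        forall g h, K g -> K h ->
          dcount R (pi (fsg_mul g h)) (fsgn_mul (pi g) (pi h)) < e
      & forall g, K g -> `|fsg_tr g - fsgn_tr R (pi g)| < e].

(* Main.v *)
Require Import Defs.
From mathcomp Require Import all_boot all_order all_algebra.
From mathcomp Require Import perm lra.
From mathcomp Require Import all_classical all_reals all_analysis.

(** The proof goes around the cycle sofic -> pair on the full group -> pair on
    the acting group -> sofic.  Every distance that occurs is a Hamming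
    distance, the measure of the points where two option-valued or boolean
    functions differ, and an equality in a metric ultraproduct is an equality of
    representatives at almost every index, in the sense of [ae].

    Sofic implies a covariant pair on the full group.  The full semigroup is
    separable, because an element is determined by the countably many Borel sets
    on which it coincides with a given group element ([fsgB_separable]).
    Sending an element to the sofic image of its best approximation among
    finitely many elements of a dense sequence produces maps that are
    asymptotically multiplicative and trace-preserving on the whole semigroup
    ([sofic_sequenceP]); the point is that approximate multiplicativity and
    preservation of traces force approximate Lipschitz continuity
    ([dcount_lipschitz]).  Along a free ultrafilter, images of partial
    identities become subsets, images of full-group elements become
    permutations, and covariance expresses that a group element conjugates
    partial identities.

    The full group contains the image of the acting group, and an isometric
    homomorphism preserves the trace, which is 1 minus the distance to the
    identity.

    A covariant trace-preserving pair on the acting group implies sofic.  Choose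
    representing permutations and subsets.  The map on sets preserves measure
    and Boolean operations almost everywhere, so almost every index has the
    same membership pattern as an actual point of the space
    ([realize_sets]).  The permutation of a group element moves almost all indices
    that represent moved points, since a countable family of Borel sets
    separates points ([model_fix_sub]); by preservation of the trace its fixed
    indices are exactly those of the fixed-point set ([model_fix]).  Hence
    almost every index looks like a point of the space, as far as finitely many
    group elements and Borel sets can tell ([realize_action]).  A partial map is
    modelled by gluing the permutations of the first m group elements along
    the images of its pieces; products and traces are then verified at points
    of the space and transferred to indices, the error being the measure of the
    points whose images require later group elements ([glued_mul], [glued_fix]).

    When the action is free, the inclusion of fixed points given by
    [model_fix_sub] makes the fixed indices of a nontrivial element negligible,
    and the trace is preserved automatically. *)

Set Implicit Arguments.
Unset Strict Implicit.
Unset Printing Implicit Defensive.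

Import Order.TTheory GRing.Theory Num.Theory.
Import numFieldNormedType.Exports.

Local Open Scope classical_set_scope.
Local Open Scope ring_scope.

(** * Frequencies in finite sets and ultralimits *)

Section Frequency.
Variables (R : realType) (n : nat).
Implicit Types P Q : 'I_n -> Prop.

Definition freq P : R := mu_count R [set i | `[< P i >]]%SET.

Lemma mu_countE (A : {set 'I_n}) : mu_count R A = freq (fun i => i \in A).
Proof. by congr (_%:R / _); apply: eq_card => i; rewrite inE asboolb. Qed.

Lemma freq_ge0 P : 0 <= freq P.
Proof. by rewrite /freq /mu_count divr_ge0. Qed.

Lemma freq_le P Q : (forall i, P i -> Q i) -> freq P <= freq Q.
Proof.
move=> PQ; rewrite ler_wpM2r ?invr_ge0// ler_nat subset_leq_card//.
by apply/fintype.subsetP => i; rewrite !inE; exact: PQ.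
Qed.

Lemma eq_freq P Q : (forall i, P i <-> Q i) -> freq P = freq Q.
Proof. by move=> PQ; apply/eqP; rewrite eq_le !freq_le// => i /PQ. Qed.

Lemma freqIU P Q :
  freq (fun i => P i /\ Q i) + freq (fun i => P i \/ Q i) = freq P + freq Q.
Proof.
rewrite /freq /mu_count -!mulrDl -!natrD; congr (_%:R / _).
rewrite addnC -[RHS]cardsUI; congr (_ + _)%N; apply: eq_card => i.
  by rewrite !(finset.in_setU, finset.in_set) asbool_or.
by rewrite !(finset.in_setI, finset.in_set) asbool_and.
Qed.

Lemma freqU_le P Q : freq (fun i => P i \/ Q i) <= freq P + freq Q.
Proof. by rewrite -freqIU lerDr freq_ge0. Qed.

Lemma freq_le2 P Q1 Q2 :
  (forall i, P i -> Q1 i \/ Q2 i) -> freq P <= freq Q1 + freq Q2.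
Proof. by move=> h; apply: le_trans (freqU_le _ _); exact: freq_le. Qed.

Lemma freqDI P Q :
  freq P = freq (fun i => P i /\ Q i) + freq (fun i => P i /\ ~ Q i).
Proof.
rewrite -freqIU [X in _ = X + _](_ : _ = 0) ?add0r.
  apply: eq_freq => i; split=> [Pi|[[]|[]]//].
  by case: (EM (Q i)) => Qi; [left|right].
rewrite /freq /mu_count eq_card0 ?mul0r// => i.
by rewrite finset.in_set; apply/asboolP => -[[_ ?] []].
Qed.

Lemma freq_False : freq (fun=> False) = 0.
Proof.
rewrite /freq /mu_count eq_card0 ?mul0r// => i.
by rewrite finset.in_set asboolF.
Qed.

Lemma freq_comp_perm (s : 'S_n) P : freq (fun i => P (s i)) = freq P.
Proof.
rewrite /freq /mu_count; congr (_%:R / _).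
rewrite -[RHS](card_imset _ (@perm_inj _ s^-1%g)); apply: eq_card => i.
rewrite inE; apply/asboolP/imsetP => [Psi|[j]].
  by exists (s i); rewrite ?permK// inE; apply/asboolP.
by rewrite inE => /asboolP Pj ->; rewrite permKV.
Qed.

Hypothesis n0 : (0 < n)%N.

Lemma freq_True P : (forall i, P i) -> freq P = 1.
Proof.
move=> hP; rewrite /freq /mu_count eq_cardT => [|i].
  by rewrite -cardT card_ord divff// pnatr_eq0 -lt0n.
by rewrite finset.in_set asboolT.
Qed.

Lemma freqC P : freq (fun i => ~ P i) = 1 - freq P.
Proof.
have := freqIU P (fun i => ~ P i).
rewrite [X in X + _](_ : _ = 0); last first.
  by rewrite -freq_False; apply: eq_freq => i; split=> // -[].
rewrite [X in _ + X = _]freq_True; last by move=> i; exact: EM.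
by move=> ?; lra.
Qed.

Lemma freq_le1 P : freq P <= 1.
Proof. by rewrite -[leRHS](@freq_True (fun=> True))//; exact: freq_le. Qed.

End Frequency.

(** Two partial maps differ at an index when exactly one of them is defined
    there, or both are and their values differ.  Each distance is therefore the
    frequency of the indices where two functions, option-valued or boolean,
    take different values, and estimates reduce to union bounds. *)
Section HammingDistances.
Variables (R : realType) (n : nat).

Lemma dMAlgnE (A B : {set 'I_n}) :
  dMAlgn R A B = freq R (fun i => (i \in A) <> (i \in B)).
Proof.
rewrite /dMAlgn mu_countE; apply: eq_freq => i; rewrite !inE.
by case: (i \in A); case: (i \in B).
Qed.

Lemma dcountE (g h : fsgn n) : dcount R g h = freq R (fun i => g i <> h i).
Proof.
rewrite /dcount dMAlgnE mu_countE.
rewrite -freqIU [X in X + _](_ : _ = 0) ?add0r; last first.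
  rewrite -(freq_False R n); apply: eq_freq => i; split => //; rewrite !inE.
  by case: (g i) => [x|]; case: (h i) => [y|]//= [].
apply: eq_freq => i; rewrite !inE; case: (g i) => [x|]; case: (h i) => [y|]//=.
- by split=> [[//|/eqP//]|/eqP]; right.
- by split=> // _; left.
- by split=> // _; left.
- by split=> [[]|].
Qed.

Lemma dpermE (s t : 'S_n) : dperm R s t = freq R (fun i => s i <> t i).
Proof.
rewrite /dperm dcountE; apply: eq_freq => i; rewrite !ffunE.
by split=> h; [move=> h'; apply: h; rewrite h'|case].
Qed.

Lemma fsgn_trE (g : fsgn n) : fsgn_tr R g = freq R (fun i => g i = Some i).
Proof.
rewrite /fsgn_tr mu_countE; apply: eq_freq => i; rewrite !inE.
by split=> [/eqP|->].
Qed.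

Lemma perm_trE (s : 'S_n) : perm_tr R s = freq R (fun i => s i = i).
Proof.
rewrite /perm_tr fsgn_trE; apply: eq_freq => i; rewrite ffunE.
by split=> [[]|->].
Qed.

End HammingDistances.

Section AlmostEverywhere.
Variables (R : realType) (U : set_system nat) (n : nat -> nat).
Implicit Types P Q : forall k, 'I_(n k) -> Prop.

Definition tends P (c : R) : Prop := freq R (P k) @[k --> U] --> c.
(** The events of limit frequency 0 are the null events of the finitely additive
    Loeb measure carried by the ultraproduct of the index sets.  Reasoning
    almost everywhere in this sense is exact: it is closed under finite
    conjunction and consequence, and it replaces bookkeeping of errors. *)
Definition ae P : Prop := tends (fun k i => ~ P k i) 0.

Context {UF : ProperFilter U}.

Lemma aeS P Q : (forall k i, P k i -> Q k i) -> ae P -> ae Q.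
Proof.
move=> PQ aP; rewrite /ae /tends.
apply: (squeeze_cvgr _ (@cvg_cst _ _ _ _ _) aP).
by apply: nearW => k; rewrite freq_ge0 freq_le// => i nQ /PQ.
Qed.

Lemma aeI P Q : ae P -> ae Q -> ae (fun k i => P k i /\ Q k i).
Proof.
move=> aP aQ; rewrite /ae /tends.
have /(_ _) h := cvgD aP aQ; rewrite addr0 in h.
apply: (squeeze_cvgr _ (@cvg_cst _ _ _ _ _) h).
apply: nearW => k /=; rewrite freq_ge0 freq_le2// => i.
by case: (EM (P k i)); [right => ?; exact: H|left].
Qed.

Lemma aeS2 P Q S :
  (forall k i, P k i -> Q k i -> S k i) -> ae P -> ae Q -> ae S.
Proof. by move=> h aP aQ; apply: aeS (aeI aP aQ) => k i []; exact: h. Qed.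

Lemma ae_true P : (forall k i, P k i) -> ae P.
Proof.
move=> hP; rewrite /ae /tends [X in X @ _](_ : _ = cst 0); first exact: cvg_cst.
apply/funext => k; rewrite -(freq_False R (n k)) /=; apply: eq_freq => i.
by split=> // /(_ (hP k i)).
Qed.

Lemma ae_seq (I : eqType) (s : seq I) (P : I -> forall k, 'I_(n k) -> Prop) :
  (forall x, x \in s -> ae (P x)) ->
  ae (fun k i => forall x, x \in s -> P x k i).
Proof.
elim: s => [_|x s ih h]; first by apply: ae_true.
have h1 : ae (P x) by apply: h; rewrite mem_head.
have h2 y : y \in s -> ae (P y) by move=> ys; apply: h; rewrite inE ys orbT.
by apply: aeS2 h1 (ih h2) => k i Px Ps y; rewrite inE => /predU1P[->//|/Ps].
Qed.

Lemma ae_fin (I : finType) (P : I -> forall k, 'I_(n k) -> Prop) :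
  (forall x, ae (P x)) -> ae (fun k i => forall x, P x k i).
Proof.
move=> h; apply: aeS (@ae_seq I (enum I) P (fun x _ => h x)) => k i hi x.
by apply: hi; rewrite mem_enum.
Qed.

(** Permutations preserve the counting measure, so that null events may be
    pulled back along a sequence of permutations. *)
Lemma ae_perm (s : forall k, 'S_(n k)) P : ae P -> ae (fun k i => P k (s k i)).
Proof.
rewrite /ae /tends => aP; rewrite [X in X @ _](_ : _ = (fun k => freq R (fun i => ~ P k i)))//.
by apply/funext => k; exact: (freq_comp_perm R (s k) (fun i => ~ P k i)).
Qed.

Lemma ae_permV (s : forall k, 'S_(n k)) P :
  ae (fun k i => P k (s k i)) -> ae P.
Proof.
move=> h; apply: aeS (ae_perm (fun k => (s k)^-1%g) h) => k i /=.
by rewrite permKV.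
Qed.

Lemma tends_unique P c c' : tends P c -> tends P c' -> c = c'.
Proof. exact: cvg_unique. Qed.

Lemma tends_le P Q a b :
  ae (fun k i => P k i -> Q k i) -> tends P a -> tends Q b -> a <= b.
Proof.
move=> aPQ Pa Qb; have /(_ _) h := cvgD Qb aPQ; rewrite addr0 in h.
apply: (ler_cvg_to Pa h); apply: nearW => k; apply: freq_le2 => i Pi.
by case: (EM (Q k i)) => [|nQ]; [left|right => /(_ Pi)].
Qed.

Lemma tends_ae P Q c : ae (fun k i => P k i <-> Q k i) -> tends P c -> tends Q c.
Proof.
move=> h Pc; rewrite /tends.
have /(_ _) lo := cvgB Pc h; have /(_ _) hi := cvgD Pc h; rewrite subr0 in lo; rewrite addr0 in hi.
apply: (squeeze_cvgr _ lo hi); apply: nearW => k /=; apply/andP; split.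
  rewrite lerBlDr; apply: freq_le2 => i Pi.
  by case: (EM (Q k i)) => [|nQ]; [left|right => -[/(_ Pi)]].
apply: freq_le2 => i Qi.
by case: (EM (P k i)) => [|nP]; [left|right => -[_ /(_ Qi)]].
Qed.

Lemma tendsU P Q p q r : tends P p -> tends Q q ->
  tends (fun k i => P k i /\ Q k i) r ->
  tends (fun k i => P k i \/ Q k i) (p + q - r).
Proof.
move=> Pp Qq PQr; rewrite /tends.
rewrite [X in X @ _](_ : _ = (fun k => freq R (P k) + freq R (Q k) - freq R (fun i => P k i /\ Q k i))).
  by apply: cvgB => //; exact: cvgD.
by apply/funext => k; rewrite -freqIU addrC addKr.
Qed.

Hypothesis n0 : forall k, (0 < n k)%N.

Lemma tendsC P c : tends P c -> tends (fun k i => ~ P k i) (1 - c).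
Proof.
move=> Pc; rewrite /tends.
rewrite [X in X @ _](_ : _ = (fun k => 1 - freq R (P k))).
  by apply: cvgB => //; exact: cvg_cst.
by apply/funext => k; rewrite freqC.
Qed.

Lemma tends1_ae P : tends P 1 <-> ae P.
Proof.
split=> [/tendsC|/tendsC]; first by rewrite subrr.
rewrite subr0; apply: tends_ae; apply: ae_true => k i.
by split=> [/contrapT|? []].
Qed.

Lemma tends0_ae P : tends P 0 <-> ae (fun k i => ~ P k i).
Proof.
rewrite /ae /tends; suff -> : (fun k => freq R (P k)) = (fun k => freq R (fun i => ~ ~ P k i)) by [].
by apply/funext => k; apply: eq_freq => i; split=> [? []//|/contrapT].
Qed.

Lemma tends_bounds P c : tends P c -> 0 <= c <= 1.
Proof.
move=> Pc; apply/andP; split.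
  by apply: (ler_cvg_to (@cvg_cst _ _ _ _ _) Pc); apply: nearW => k; exact: freq_ge0.
by apply: (ler_cvg_to Pc (@cvg_cst _ _ _ _ _)); apply: nearW => k; exact: freq_le1.
Qed.

End AlmostEverywhere.

Section UltraLimits.
Variables (R : realType) (U : set_system nat).
Context {UU : UltraFilter U}.
Variables (n : nat -> nat) (n0 : forall k, (0 < n k)%N).

(** Frequencies lie in the compact interval from 0 to 1, where an ultrafilter
    converges. *)
Lemma ultra_tends (P : forall k, 'I_(n k) -> Prop) : exists c : R, tends U P c.
Proof.
have [|c [_ clc]] := @segment_compact R 0 1 (freq R (P k) @[k --> U]) _.
  by apply: nearW => k /=; rewrite in_itv/= freq_ge0 freq_le1.
exists c; apply/cvgrPdist_le => e e0.
have [//|nU] := in_ultra_setVsetC [set k | `|c - freq R (P k)| <= e] UU.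
have : nbhs c [set x : R | `|c - x| <= e].
  by have := nbhsx_ballx c _ e0; apply: filterS => x; rewrite /ball/= => /ltW.
move=> /(clc [set x : R | ~ `|c - x| <= e] _ nU) [x [/= ? ?]].
by [].
Qed.

Lemma tends_lim (P : forall k, 'I_(n k) -> Prop) (f : nat -> R) :
  (forall k, f k = freq R (P k)) -> tends U P (lim (f @ U)).
Proof.
move=> fP; have [c Pc] := ultra_tends P.
have fc : f @ U --> c.
  by rewrite (_ : f = fun k => freq R (P k))//; apply/funext.
by rewrite (cvg_lim _ fc).
Qed.

(** The points of [M k] are compared through their values [ev x i] at the
    indices; permutations and subsets are both of this kind, and equality in
    their metric ultraproducts is equality of the values almost everywhere. *)
Variables (M V : nat -> Type) (dist : forall k, M k -> M k -> R).
Variable ev : forall k, M k -> 'I_(n k) -> V k.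
Hypothesis distE : forall k x y,
  dist x y = freq R (fun i => ev x i <> ev y i :> V k).

Local Notation D :=
  (fun x y : forall k, M k => lim ((fun k => dist (x k) (y k)) @ U)).

Lemma tends_ulim x y :
  tends U (fun k i => ev (x k) i <> ev (y k) i) (D x y).
Proof. by apply: tends_lim => k; exact: distE. Qed.

Lemma ulim0P x y :
  D x y = 0 <-> ae R U (fun k i => ev (x k) i = ev (y k) i).
Proof.
split=> [xy0|]; first by rewrite /ae -xy0; exact: tends_ulim.
by move=> h; exact: (tends_unique (@tends_ulim x y) h).
Qed.

Lemma mcls_ulim x y :
  mcls D x = mcls D y <-> ae R U (fun k i => ev (x k) i = ev (y k) i).
Proof.
rewrite -ulim0P; split=> [/(congr1 (fun q => sval q y))/=|xy0].
  move=> ->; apply/ulim0P; exact: ae_true.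
apply: eq_exist; apply/seteqP; split=> z /=; move: xy0; rewrite !ulim0P;
  by apply: aeS2 => k i -> // ->.
Qed.

End UltraLimits.

(** * Probability masses and standard Borel spaces *)

Section Mass.
Variables (R : realType) (d : measure_display) (X : measurableType d).
Variable mu : probability X R.
Implicit Types A B : set X.

Definition mass A : R := fine (mu A).

Lemma massE A : measurable A -> (mass A)%:E = mu A.
Proof. by move=> mA; rewrite /mass fineK// fin_num_measure. Qed.

Lemma mass_ge0 A : 0 <= mass A.
Proof. by rewrite /mass fine_ge0. Qed.

Lemma mass0 : mass set0 = 0.
Proof. by rewrite /mass measure0. Qed.

Lemma massT : mass setT = 1.
Proof. by rewrite /mass probability_setT. Qed.

Lemma mass_le A B : measurable A -> measurable B -> A `<=` B -> mass A <= mass B.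
Proof.
by move=> mA mB AB; rewrite -lee_fin !massE// le_measure// ?inE.
Qed.

Lemma massIU A B : measurable A -> measurable B ->
  mass (A `&` B) + mass (A `|` B) = mass A + mass B.
Proof.
move=> mA mB; apply: EFin_inj; rewrite !EFinD !massE//; last 2 first.
- exact: measurableU.
- exact: measurableI.
rewrite -(setDUK (_ : A `<=` A `|` B)); last by move=> ?; left.
rewrite measureU//; last 2 first.
- by apply: measurableD => //; exact: measurableU.
- by apply/seteqP; split=> // x [Ax [_]].
rewrite [X in (_ = _ + X)%E](measureDI mu mB mA).
rewrite (_ : (A `|` B) `\` A = B `\` A); last first.
  by apply/seteqP; split=> [x [[//|Bx] nAx]|x [Bx nAx]]; split=> //; right.
by rewrite setIC [in LHS]addeC addeA.
Qed.

Lemma massU_le A B : measurable A -> measurable B ->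
  mass (A `|` B) <= mass A + mass B.
Proof. by move=> mA mB; rewrite -massIU// lerDr mass_ge0. Qed.

Lemma mass_le2 C A B : measurable A -> measurable B -> measurable C ->
  C `<=` A `|` B -> mass C <= mass A + mass B.
Proof.
move=> mA mB mC CAB; apply: le_trans (massU_le mA mB).
by apply: mass_le => //; exact: measurableU.
Qed.

Lemma massC A : measurable A -> mass (~` A) = 1 - mass A.
Proof.
move=> mA; have := massIU mA (measurableC mA).
by rewrite setICr setUCr mass0 massT add0r => ->; rewrite addrC addKr.
Qed.

Lemma mass_bigcup (F : nat -> set X) (e : nat -> R) N :
  (forall i, measurable (F i)) -> (forall i, mass (F i) <= e i) ->
  mass (\bigcup_(i in `I_N) F i) <= \sum_(i < N) e i.
Proof.
move=> mF Fe; elim: N => [|N ih].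
  by rewrite II0 bigcup_set0 mass0 big_ord0.
rewrite big_ord_recr/=.
apply: (le_trans _ (lerD ih (Fe N))); apply: mass_le2 => //.
- by apply: bigcup_measurable => k _.
- by apply: bigcup_measurable => k _.
move=> x [i /=]; rewrite ltnS leq_eqVlt => /predU1P[->|iN] Fx; [by right|left].
by exists i.
Qed.

Lemma mass_cvg0 (F : nat -> set X) : (forall i, measurable (F i)) ->
  (forall i j, (i <= j)%N -> F j `<=` F i) -> (forall x, exists i, ~ F i x) ->
  mass (F i) @[i --> \oo] --> 0.
Proof.
move=> mF decF F0.
have cap0 : \bigcap_n F n = set0.
  by apply/seteqP; split => // x Fx; have [i] := F0 x; case; exact: Fx.
have : mu \o F @ \oo --> mu (\bigcap_n F n).
  apply: nonincreasing_cvg_mu => //.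
  - by rewrite ltey_eq fin_num_measure.
  - by rewrite cap0.
  - by move=> i j ij; apply/subsetPset; exact: decF.
by rewrite cap0 measure0 => /fine_cvgP[].
Qed.

Definition tail (A : nat -> set X) N : set X :=
  \bigcup_i A i `\` \bigcup_(i in `I_N) A i.

Lemma measurable_tail (A : nat -> set X) N : (forall i, measurable (A i)) -> measurable (tail A N).
Proof. by move=> mA; apply: measurableD; apply: bigcup_measurable => k _. Qed.

Lemma mass_tail (A : nat -> set X) : (forall i, measurable (A i)) -> mass (tail A N) @[N --> \oo] --> 0.
Proof.
move=> mA; apply: mass_cvg0.
- by move=> N; exact: measurable_tail.
- move=> i j ij x [Ax nAx]; split=> // -[k /= ki Akx]; apply: nAx; exists k => //=.
  exact: leq_trans ij.
- move=> x; have [[i _ Aix]|nA] := pselect ((\bigcup_i A i) x).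
    by exists i.+1 => -[_]; apply; exists i => /=.
  by exists 0%N => -[].
Qed.

End Mass.

Section StandardBorel.
Variables (R : realType) (d : measure_display) (X : measurableType d).
Variable mu : probability X R.

(** The algebra of sets generated by a countable family, presented as the
    values of an evaluation on a countable type of terms: an inner node stands
    for the complement of the union of its children. *)
Fixpoint eval_tree (V : nat * nat -> set X) (t : GenTree.tree (nat * nat)) : set X :=
  match t with
  | GenTree.Leaf nm => V nm
  | GenTree.Node _ l => ~` foldr (fun t A => eval_tree V t `|` A) set0 l
  end.

Variable V : nat * nat -> set X.
Hypothesis mV : forall nm, measurable (V nm).

Lemma eval_node k l x :
  eval_tree V (GenTree.Node k l) x <-> forall t, t \in l -> ~ eval_tree V t x.
Proof.
rewrite [eval_tree _ _]/=; elim: l => [|t l ih] /=.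
  by split=> // _ [].
split=> [nVl u|h [Vt|Vl]].
- rewrite inE => /predU1P[->|ul] Vu; apply: nVl; first by left.
  by right; apply: contrapT => nl; move/ih: nl => /(_ u ul).
- by apply: (h t) => //; exact: mem_head.
- by move: Vl; apply/ih => u ul; apply: h; rewrite inE ul orbT.
Qed.

Lemma eval_empty : eval_tree V (GenTree.Node 0 [:: GenTree.Node 0 [::]]) = set0.
Proof.
apply/seteqP; split=> // x; rewrite eval_node.
by move=> /(_ _ (mem_head _ _)) []; rewrite eval_node.
Qed.

Lemma eval_compl t : eval_tree V (GenTree.Node 0 [:: t]) = ~` eval_tree V t.
Proof.
apply/seteqP; split=> x; rewrite eval_node; first by apply; exact: mem_head.
by move=> nt u; rewrite mem_seq1 => /eqP ->.
Qed.

Definition fin_union (s : seq (GenTree.tree (nat * nat))) : GenTree.tree (nat * nat) :=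
  GenTree.Node 0 [:: GenTree.Node 0 s].

Lemma eval_fin_union s x :
  eval_tree V (fin_union s) x <-> exists2 t, t \in s & eval_tree V t x.
Proof.
rewrite eval_node; split=> [h|[t ts Vt] u].
  apply: contrapT => nex; apply: (h (GenTree.Node 0 s)); first exact: mem_head.
  by rewrite eval_node => t ts Vt; apply: nex; exists t.
by rewrite mem_seq1 => /eqP ->; rewrite eval_node => /(_ t ts).
Qed.

Lemma measurable_eval t : measurable (eval_tree V t).
Proof.
elim/GenTree.tree_ind: t => [nm|k l] //=.
elim: l => [_|t l ih [mt ml]]; apply: measurableC => //=.
by apply: measurableU => //; move: (measurableC (ih ml)); rewrite /= setCK.
Qed.

Definition approximable (A : set X) : Prop :=
  measurable A /\ forall e, 0 < e -> exists t, mass mu (A `+` eval_tree V t) < e.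

Lemma approximableV nm : approximable (V nm).
Proof.
split=> // e e0; exists (GenTree.Leaf nm).
by rewrite /= setYK mass0.
Qed.

Lemma measurableY A B : measurable A -> measurable B -> measurable (A `+` B : set X).
Proof. by move=> mA mB; apply: measurableU; exact: measurableD. Qed.

Lemma approximableC A : approximable A -> approximable (~` A).
Proof.
move=> [mA hA]; split=> [|e e0]; first exact: measurableC.
have [t] := hA e e0; exists (GenTree.Node 0 [:: t]); rewrite eval_compl.
rewrite (_ : _ `+` _ = A `+` eval_tree V t)//.
rewrite /setY !setDE !setCK; apply/seteqP; split => x /= [] [? ?];
  solve [by left|by right].
Qed.

(** Finitely many terms exhaust the union up to half of the allowed error, and
    the other half is shared out among the approximations of these terms. *)
Lemma approximable_bigcup (A : nat -> set X) :
  (forall i, approximable (A i)) -> approximable (\bigcup_i A i).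
Proof.
move=> hA; have mA i : measurable (A i) by case: (hA i).
split=> [|e e0]; first exact: bigcup_measurable.
have e20 : 0 < e / 2 by rewrite divr_gt0.
have [N _ /(_ _ (leqnn N)) tN] : \forall N \near \oo, mass mu (tail A N) < e / 2.
  by have /cvgr_lt := @mass_tail _ _ _ mu A mA; apply.
pose r := e / 2 / N.+1%:R.
have r0 : 0 < r by rewrite divr_gt0.
have {}hA i : exists t, mass mu (A i `+` eval_tree V t) < r by case: (hA i) => _; apply.
pose t i := sval (cid (hA i)).
have ht i : mass mu (A i `+` eval_tree V (t i)) < r by exact: (svalP (cid (hA i))).
exists (fin_union [seq t i | i <- iota 0 N]).
have : mass mu (\bigcup_(i in `I_N) (A i `+` eval_tree V (t i))) <= \sum_(i < N) r.
  apply: (@mass_bigcup _ _ _ mu (fun i => A i `+` eval_tree V (t i)) (fun=> r)) => i.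
    by apply: measurableY => //; exact: measurable_eval.
  exact: ltW.
rewrite sumr_const card_ord => hs.
have {}hs : mass mu (\bigcup_(i in `I_N) (A i `+` eval_tree V (t i))) <= e / 2.
  apply: le_trans hs _; rewrite -[leLHS]mulr_natr /r [leLHS]mulrAC ler_pdivrMr ?ltr0n//.
  by rewrite ler_wpM2l ?ler_nat// ltW.
rewrite [ltRHS]splitr; apply: le_lt_trans (ltr_leD tN hs).
apply: mass_le2.
- exact: measurable_tail.
- apply: bigcup_measurable => i _; apply: measurableY => //; exact: measurable_eval.
- by apply: measurableY; [exact: bigcup_measurable|exact: measurable_eval].
move=> x [] [].
  move=> Ax nx; have [[i iN Aix]|nA] := pselect ((\bigcup_(i in `I_N) A i) x); last by left.
  right; exists i => //; left; split => // Vx; apply: nx; apply/eval_fin_union.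
  by exists (t i) => //; apply: map_f; rewrite mem_iota.
move=> /eval_fin_union[u /mapP[i]]; rewrite mem_iota/= => iN -> Vx nA.
by right; exists i => //; right; split=> // Aix; apply: nA; exists i.
Qed.

End StandardBorel.

(** The interiors of the balls of radius 1 / (m + 1) around a countable dense set
    form a basis of the topology.  They separate points because the space is
    Hausdorff, and the algebra that
    they generate is dense in measure because the approximable sets form a
    sigma-algebra containing the open sets. *)
Lemma standard_borel_basis (R : realType) (d : measure_display)
    (X : measurableType d) (mu : probability X R) : standard_borel R X ->
  exists B : nat -> set X, [/\ forall s, measurable (B s),
    forall x y, (forall s, B s x <-> B s y) -> x = y &
    forall A e, measurable A -> 0 < e -> exists s, mass mu (A `+` B s) < e].
Proof.
move=> [P [f [hP [D cD dD] bf mf]]].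
have /countable_injP[c cinj] := cD.
pose W (nm : nat * nat) : set P :=
  [set y | exists p, [/\ D p, c p = nm.1 & ((ball p nm.2.+1%:R^-1)° : set P) y]].
have oW nm : open (W nm).
  rewrite (_ : W nm = \bigcup_(p in [set p | D p /\ c p = nm.1]) (ball p nm.2.+1%:R^-1)°).
    by apply: bigcup_open => p _; exact: open_interior.
  by apply/seteqP; split=> [y [p [? ? ?]]|y [p [? ?] ?]]; exists p.
have Wbase (O : set P) y : open O -> O y -> exists2 nm, W nm y & W nm `<=` O.
  move=> oO Oy; have : nbhs y O by exact: open_nbhs_nbhs.
  move=> /nbhs_ballP[e /= e0 eO].
  have e20 : 0 < e / 2 by rewrite divr_gt0.
  (* a ball of radius r around a dense point within r / 2 of y stays in O *)
  have [m _ /(_ _ (leqnn m))/= hm] := near_infty_natSinv_lt (PosNum e20).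
  pose r : R := m.+1%:R^-1.
  have r0 : 0 < r by rewrite invr_gt0.
  have [||p [yp Dp]] := dD (ball y (r / 2))°.
  - exists y; have r20 : 0 < r / 2 by rewrite divr_gt0.
    by have [] := open_nbhs_ball y (PosNum r20).
  - exact: open_interior.
  have {}yp := interior_subset yp.
  exists (c p, m).
    exists p; split => //=.
    apply/nbhs_ballP; exists (r / 2) => /=; first by rewrite divr_gt0.
    move=> z yz; rewrite -/r (splitr r); apply: ball_triangle yz.
    exact: ball_sym.
  move=> z [q [Dq /= cq qz]]; have qp : q = p by apply: cinj; rewrite ?inE.
  apply: eO; have {qz} := interior_subset qz; rewrite qp -/r => pz.
  apply: le_ball (ball_triangle yp pz).
  by rewrite (le_trans _ (_ : r + r <= e))//; rewrite -/r in hm; lra.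
pose V nm := f @^-1` W nm.
have fK B : f @` (f @^-1` B) = B.
  apply/seteqP; split => [_ [x Bx <-]//|y By].
  by have [g _ gK] := bf; exists (g y); rewrite /preimage/= ?gK.
have mO (O : set P) : <<s [set B : set P | open B] >> O -> measurable (f @^-1` O).
  by move=> sO; apply/mf; rewrite fK.
have mV nm : measurable (V nm) by apply: (mO (W nm)); apply: sub_sigma_algebra; exact: oW.
have appO (O : set P) : <<s [set B : set P | open B] >> O -> approximable mu V (f @^-1` O).
  move: O; apply: smallest_sub.
    split=> [|A hA|F hF].
    - rewrite preimage_set0; split=> // e e0.
      exists (GenTree.Node 0 [:: GenTree.Node 0 [::]]).
      by rewrite eval_empty setYK mass0.
    - by rewrite setTD preimage_setC; exact: approximableC.
    - by rewrite preimage_bigcup; exact: approximable_bigcup.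
  move=> O oO.
  pose S k := if unpickle k is Some nm then if `[< W nm `<=` O >] then V nm else set0 else set0.
  have -> : f @^-1` O = \bigcup_k S k.
    apply/seteqP; split=> x /=.
      move=> Ox; have [nm Wx WO] := Wbase _ _ oO Ox.
      exists (pickle nm) => //; rewrite /S pickleK.
      by case: asboolP.
    by move=> [k _]; rewrite /S; case: unpickle => // nm; case: asboolP => // WO /WO.
  apply: approximable_bigcup => // k; rewrite /S.
  have a0 : approximable mu V set0.
    split=> // e e0; exists (GenTree.Node 0 [:: GenTree.Node 0 [::]]).
    by rewrite eval_empty setYK mass0.
  by case: unpickle => // nm; case: ifP => // _; exact: approximableV.
exists (fun s => if unpickle s is Some t then eval_tree V t else set0); split.
- by move=> s; case: unpickle => // t; exact: measurable_eval.
- move=> x y xy; apply: (bij_inj bf); apply: contrapT => /eqP fxy.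
  move: hP; rewrite open_hausdorff => hP'; have [OO h1 h2] := hP' _ _ fxy.
  case: OO h1 h2 => O O' /= [fxO fyO'] [oO _ /eqP OO'].
  have [nm Wx WO] := Wbase O (f x) oO (set_mem fxO).
  have := xy (pickle (GenTree.Leaf nm)); rewrite pickleK => -[/(_ Wx) Vy _].
  have : (O `&` O') (f y) by split; [exact: WO|exact: set_mem].
  by rewrite OO'.
- move=> A e mA e0.
  have fA : A = f @^-1` (f @` A).
    apply/seteqP; split => [x Ax|x [y Ay /(bij_inj bf)<-//]].
    by exists x.
  have happ : approximable mu V (f @^-1` (f @` A)) by apply: appO; exact/mf.
  have [t] := happ.2 e e0.
  by rewrite -fA => ?; exists (pickle t); rewrite pickleK.
Qed.

(** * The measure algebra and the full semigroup as Hamming spaces *)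

Section SymmetricDifference.
Variables (R : realType) (d : measure_display) (X : measurableType d).
Variable mu : probability X R.
Implicit Types A B C : borel_set X.

Lemma dMAlg_xx A : dMAlg mu A A = 0.
Proof. by rewrite /dMAlg setYK measure0. Qed.

Lemma dMAlgC A B : dMAlg mu A B = dMAlg mu B A.
Proof. by rewrite /dMAlg setYC. Qed.

Lemma dMAlg_ge0 A B : 0 <= dMAlg mu A B.
Proof. exact: mass_ge0. Qed.

Lemma dMAlg_triangle A B C : dMAlg mu A C <= dMAlg mu A B + dMAlg mu B C.
Proof.
apply: mass_le2; [exact: measurableY (svalP _) (svalP _)..|].
move=> x [] [h1 h2]; have [Bx|nBx] := pselect (sval B x).
- by right; left.
- by left; left.
- by left; right.
- by right; right.
Qed.

Lemma mcls_MAlg A B : mcls (dMAlg mu) A = mcls (dMAlg mu) B <-> dMAlg mu A B = 0.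
Proof.
apply: mcls_eq; [exact: dMAlg_xx|exact: dMAlgC|exact: dMAlg_ge0|].
by move=> *; exact: dMAlg_triangle.
Qed.

Lemma mrepr_MAlg A : dMAlg mu (mrepr (mcls (dMAlg mu) A)) A = 0.
Proof. by apply/mcls_MAlg; exact: mreprK. Qed.

Lemma MAlg_cap_mcls A B :
  MAlg_cap (mcls (dMAlg mu) A) (mcls (dMAlg mu) B) = mcls (dMAlg mu) (borel_setI A B).
Proof.
apply/mcls_MAlg/eqP; rewrite eq_le dMAlg_ge0 andbT.
have le0 := (mrepr_MAlg A, mrepr_MAlg B).
apply: (@le_trans _ _ (dMAlg mu (mrepr (mcls (dMAlg mu) A)) A
  + dMAlg mu (mrepr (mcls (dMAlg mu) B)) B)); last by rewrite !le0 addr0.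
apply: mass_le2; [exact: measurableY (svalP _) (svalP _)..|].
move=> x; set A' := mrepr _; set B' := mrepr _ => /= -[] [[]].
  move=> A'x B'x nAB; have [Ax|nAx] := pselect (sval A x); last by left; left.
  by right; left; split=> // Bx; apply: nAB.
move=> Ax Bx nAB; have [A'x|nA'x] := pselect (sval A' x); last by left; right.
by right; right; split=> // B'x; apply: nAB.
Qed.

End SymmetricDifference.

Definition countably_separated d (X : measurableType d) : Prop :=
  exists B : nat -> set X, (forall s, measurable (B s)) /\
    forall x y, (forall s, B s x <-> B s y) -> x = y.

Section FullSemigroup.
Variables (R : realType) (d : measure_display) (X : measurableType d).
Variable mu : probability X R.
Hypothesis sepX : countably_separated X.
Variable E : cber X.
Implicit Types g h : fsgB E.

Definition neqset g h : set X := [set x | g x <> h x].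

Lemma measurable_pdom g : measurable (pdom g).
Proof.
rewrite (_ : pdom g = ppreimage g setT); first exact: fsgB_preimage.
by apply/seteqP; split=> [x|x [y _ gx]]; rewrite /pdom /ppreimage/= ?gx//; case: (g x) => // y; exists y.
Qed.

(** Points being separated by countably many Borel sets, two partial maps differ
    somewhere only if their domains do or if the preimages of one of these sets
    do. *)
Lemma measurable_neqset g h : measurable (neqset g h).
Proof.
have [B [mB sB]] := sepX.
rewrite (_ : neqset g h = (pdom g `+` pdom h) `|`
  \bigcup_s (ppreimage g (B s) `+` ppreimage h (B s))).
  apply: measurableU; first by apply: measurableY; exact: measurable_pdom.
  by apply: bigcup_measurable => s _; apply: measurableY; exact: fsgB_preimage.
apply/seteqP; split=> x; rewrite /neqset /pdom /ppreimage /=.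
  move=> gh; apply: contrapT => /not_orP[nd ns]; apply: gh.
  case gx: (g x) nd => [y|]; case hx: (h x) => [z|]// nd.
  - congr Some; apply: sB => s; split=> Bs; apply: contrapT => nBs; apply: ns;
      exists s => //; [left|right].
    + by split=> [|[y']]; [exists y|rewrite hx => By' -[zy']; apply: nBs; rewrite zy'].
    + by split=> [|[y']]; [exists z|rewrite gx => By' -[zy']; apply: nBs; rewrite zy'].
  - by case: nd; left.
  - by case: nd; right.
case=> [[] [] gx hx gh|[s _] [] [] []].
- by apply: hx; rewrite /= -gh.
- by apply: hx; rewrite /= gh.
- by move=> y By gy nh gh; apply: nh; exists y; rewrite // -gh.
- by move=> y By hy ng gh; apply: ng; exists y; rewrite // gh.
Qed.

Lemma dmuE g h : dmu mu g h = mass mu (neqset g h).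
Proof.
rewrite /dmu -/(mass mu _) -/(mass mu [set x | _]).
set D := _ `+` _; set S := [set x | _].
have mD : measurable D by apply: measurableY; exact: measurable_pdom.
have -> : S = neqset g h `\` D.
  apply/seteqP; split=> x.
    by move=> [gx hx gh]; split=> // -[] [].
  move=> [gh nD]; have [gx|ngx] := pselect (pdom g x).
    have [hx|nhx] := pselect (pdom h x); first by split.
    by case: nD; left.
  have [hx|nhx] := pselect (pdom h x); first by case: nD; right.
  by move: gh ngx nhx; rewrite /neqset /pdom /=; case: (g x) => //; case: (h x).
rewrite -massIU//; last by apply: measurableD => //; exact: measurable_neqset.
rewrite setDIK mass0 add0r setDUK// => x [] [] gx hx;
  by move: gx hx; rewrite /neqset /pdom /=; case: (g x) => //; case: (h x).
Qed.

Lemma dmu_xx g : dmu mu g g = 0.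
Proof.
by rewrite dmuE (_ : neqset g g = set0) ?mass0//; apply/seteqP; split=> // x; apply.
Qed.

Lemma dmu_ext g h : (forall x, g x = h x) -> dmu mu g h = 0.
Proof.
move=> gh; rewrite dmuE (_ : neqset g h = set0) ?mass0//.
by apply/seteqP; split=> // x; apply.
Qed.

Lemma dmuC g h : dmu mu g h = dmu mu h g.
Proof.
by rewrite !dmuE; congr mass; apply/seteqP; split=> x; exact: nesym.
Qed.

Lemma dmu_ge0 g h : 0 <= dmu mu g h.
Proof. by rewrite dmuE mass_ge0. Qed.

Lemma dmu_triangle g h k : dmu mu g k <= dmu mu g h + dmu mu h k.
Proof.
rewrite !dmuE; apply: mass_le2; [exact: measurable_neqset..|].
move=> x gk; have [gh|gh] := pselect (g x = h x); last by left.
by right; rewrite /neqset/= -gh.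
Qed.

Lemma mcls_dmu g h : mcls (dmu mu (E:=E)) g = mcls (dmu mu (E:=E)) h <-> dmu mu g h = 0.
Proof.
apply: mcls_eq; [exact: dmu_xx|exact: dmuC|exact: dmu_ge0|].
by move=> *; exact: dmu_triangle.
Qed.

Lemma mrepr_dmu g : dmu mu (mrepr (mcls (dmu mu (E:=E)) g)) g = 0.
Proof. by apply/mcls_dmu; exact: mreprK. Qed.

Lemma mcls_ext g h : (forall x, g x = h x) -> mcls (dmu mu (E:=E)) g = mcls (dmu mu (E:=E)) h.
Proof. by move=> gh; apply/mcls_dmu; exact: dmu_ext. Qed.

Definition fixset g : set X := [set x | g x = Some x].

Lemma measurable_fixset g : measurable (fixset g).
Proof.
rewrite (_ : fixset g = ~` neqset g (fsgB_id E)).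
  by apply: measurableC; exact: measurable_neqset.
by apply/seteqP; split=> [x ? //|x /contrapT].
Qed.

Lemma mass_fixset_le g h : mass mu (fixset g) <= mass mu (fixset h) + dmu mu g h.
Proof.
rewrite dmuE; apply: mass_le2;
  [exact: measurable_fixset|exact: measurable_neqset|exact: measurable_fixset|].
move=> x gx; have [gh|gh] := pselect (g x = h x); last by right.
by left; rewrite /fixset/= -gh.
Qed.

Lemma fsg_tr_mcls g : fsg_tr (mcls (dmu mu (E:=E)) g) = mass mu (fixset g).
Proof.
apply/eqP; rewrite eq_le; apply/andP; split.
  by have := mass_fixset_le (mrepr (mcls (dmu mu (E:=E)) g)) g; rewrite mrepr_dmu addr0.
by have := mass_fixset_le g (mrepr (mcls (dmu mu (E:=E)) g)); rewrite dmuC mrepr_dmu addr0.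
Qed.

Section Inverse.
Variable g : fsgB E.

(** The inverse exchanges images and preimages, hence is Borel at once. *)
Definition pinv_fun (y : X) : option X :=
  if pselect (exists x, g x = Some y) is left h then Some (sval (cid h)) else None.

Lemma pinv_funP x y : pinv_fun y = Some x <-> g x = Some y.
Proof.
rewrite /pinv_fun; case: pselect => [h|nh]; split=> //.
- by case=> <-; exact: (svalP (cid h)).
- by move=> gx; congr Some; apply: (fsgB_inj (svalP (cid h)) gx).
- by move=> gx; case: nh; exists x.
Qed.

Lemma pinv_inj : pinjective pinv_fun.
Proof. by move=> x y z /pinv_funP gz /pinv_funP; rewrite gz => -[]. Qed.

Lemma pinv_preimage B : measurable B -> measurable (ppreimage pinv_fun B).
Proof.
move=> mB; rewrite (_ : ppreimage _ _ = pimage g B); first exact: fsgB_image.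
by apply/seteqP; split=> [y [x Bx /pinv_funP]|y [x Bx /pinv_funP]]; exists x.
Qed.

Lemma pinv_image A : measurable A -> measurable (pimage pinv_fun A).
Proof.
move=> mA; rewrite (_ : pimage _ _ = ppreimage g A); first exact: fsgB_preimage.
by apply/seteqP; split=> [y [x Bx /pinv_funP]|y [x Bx /pinv_funP]]; exists x.
Qed.

Lemma pinv_rel x y : pinv_fun x = Some y -> E x y.
Proof. by move=> /pinv_funP/fsgB_rel; exact: cber_sym. Qed.

Definition fsgB_inv : fsgB E := FsgB pinv_inj pinv_preimage pinv_image pinv_rel.

End Inverse.

Section Restriction.
Variable A : borel_set X.

Definition pid_fun (x : X) : option X := if `[< sval A x >] then Some x else None.

Lemma pid_funP x y : pid_fun x = Some y <-> sval A x /\ x = y.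
Proof.
rewrite /pid_fun; case: asboolP => Ax; split=> //; first by case=> <-.
  by case=> _ ->.
by case.
Qed.

Lemma pid_fun_in x : sval A x -> pid_fun x = Some x.
Proof. by move=> Ax; apply/pid_funP. Qed.

Lemma pid_fun_out x : ~ sval A x -> pid_fun x = None.
Proof. by rewrite /pid_fun; case: asboolP. Qed.

Lemma pid_inj : pinjective pid_fun.
Proof. by move=> x y z /pid_funP[_ ->] /pid_funP[_ ->]. Qed.

Lemma pid_preimage B : measurable B -> measurable (ppreimage pid_fun B).
Proof.
move=> mB; rewrite (_ : ppreimage _ _ = sval A `&` B).
  by apply: measurableI => //; exact: svalP.
apply/seteqP; split=> y; last by case=> Ay By; exists y => //; exact: pid_fun_in.
by case=> x Bx /pid_funP[Ay yx]; split=> //; rewrite yx.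
Qed.

Lemma pid_image B : measurable B -> measurable (pimage pid_fun B).
Proof.
move=> mB; rewrite (_ : pimage _ _ = sval A `&` B).
  by apply: measurableI => //; exact: svalP.
apply/seteqP; split=> y; last by case=> Ay By; exists y => //; exact: pid_fun_in.
by case=> x Bx /pid_funP[Ax xy]; rewrite -xy; split.
Qed.

Lemma pid_rel x y : pid_fun x = Some y -> E x y.
Proof. by move=> /pid_funP[_ ->]; exact: cber_refl. Qed.

Definition fsgB_restr : fsgB E := FsgB pid_inj pid_preimage pid_image pid_rel.

End Restriction.

Lemma fixset_restr A : fixset (fsgB_restr A) = sval A.
Proof. by apply/seteqP; split=> [x /pid_funP[]|x Ax] //; exact: pid_fun_in. Qed.

Definition dom_set g : borel_set X := exist _ (pdom g) (measurable_pdom g).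

Hypothesis pmpE : measure_preserving mu E.

(** The image of the preimage is contained in the set, and [g] preserves the
    mass of subsets of its domain. *)
Lemma mass_ppreimage g (N : set X) : measurable N ->
  mass mu (ppreimage g N) <= mass mu N.
Proof.
move=> mN; rewrite /mass -(pmpE (g := g)); last 2 first.
- exact: fsgB_preimage.
- by move=> x [y _ gx]; rewrite /pdom/= gx.
apply: mass_le => //; first by apply: fsgB_image; exact: fsgB_preimage.
by move=> y [x [z Nz]]; rewrite /= => -> [<-].
Qed.

Lemma dmu_mul g g' h h' :
  dmu mu (fsgB_mul g h) (fsgB_mul g' h') <= dmu mu g g' + dmu mu h h'.
Proof.
rewrite !dmuE; apply: le_trans (lerD (mass_ppreimage h (measurable_neqset g g')) (lexx _)).
apply: mass_le2.
- by apply: fsgB_preimage; exact: measurable_neqset.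
- exact: measurable_neqset.
- exact: measurable_neqset.
move=> x; have [hh|?] := pselect (h x = h' x); last by right.
rewrite /neqset /= /pcomp -hh; case hx: (h x) => [y|]//= gg.
by left; exists y.
Qed.

Lemma fsg_mul_mcls g h :
  fsg_mul (mcls (dmu mu (E:=E)) g) (mcls (dmu mu (E:=E)) h) = mcls (dmu mu (E:=E)) (fsgB_mul g h).
Proof.
apply/mcls_dmu/eqP; rewrite eq_le dmu_ge0 andbT.
by apply: le_trans (dmu_mul _ _ _ _) _; rewrite !mrepr_dmu addr0.
Qed.

Lemma fsg_dist_mcls g h :
  Defs.mdist (mcls (dmu mu (E:=E)) g) (mcls (dmu mu (E:=E)) h) = dmu mu g h.
Proof.
rewrite /Defs.mdist; set g' := mrepr _; set h' := mrepr _.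
have g0 : dmu mu g' g = 0 by exact: mrepr_dmu.
have h0 : dmu mu h' h = 0 by exact: mrepr_dmu.
have := (dmuC g g', dmuC h h', dmu_triangle g' g h', dmu_triangle g h h',
  dmu_triangle g g' h, dmu_triangle g' h' h).
by move=> [[[[[]]]]] *; lra.
Qed.

Lemma mass_pimage g (A : set X) : measurable A -> A `<=` pdom g ->
  mass mu (pimage g A) = mass mu A.
Proof. by move=> mA Ag; rewrite /mass pmpE. Qed.

Lemma total_mul_inv g x : fsgB_total g -> fsgB_mul (fsgB_inv g) g x = Some x.
Proof.
move=> [dg _]; have : pdom g x by rewrite dg.
rewrite /pdom /= /pcomp; case gx: (g x) => [y|]//= _.
by apply/pinv_funP.
Qed.

Lemma total_fun g x : fsgB_total g -> exists y, g x = Some y.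
Proof.
move=> [dg _]; have : pdom g x by rewrite dg.
by rewrite /pdom /=; case: (g x) => // y _; exists y.
Qed.

(** The images of a set under [g] and [h] can only differ inside the images of
    the set where [g] and [h] disagree. *)
Lemma dMAlg_act g h A :
  dMAlg mu (fsgB_act g A) (fsgB_act h A) <= dmu mu g h + dmu mu g h.
Proof.
have mN := measurable_neqset g h.
have mg (f : fsgB E) : measurable (neqset g h `&` pdom f).
  by apply: measurableI => //; exact: measurable_pdom.
have im_le (f : fsgB E) : mass mu (pimage f (neqset g h `&` pdom f)) <= dmu mu g h.
  by rewrite dmuE mass_pimage//; apply: mass_le => // x [].
apply: le_trans (lerD (im_le g) (im_le h)); apply: mass_le2.
- exact: fsgB_image.
- exact: fsgB_image.
- exact: measurableY (svalP _) (svalP _).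
move=> y [] [[x Ax fx] nfx]; [left|right]; exists x => //.
  by split; [move=> gh; apply: nfx; exists x; rewrite // -gh|rewrite /pdom/= fx].
by split; [move=> gh; apply: nfx; exists x; rewrite // gh|rewrite /pdom/= fx].
Qed.

End FullSemigroup.

(** * Separability of the full semigroup *)

Section Separability.
Variables (R : realType) (d : measure_display) (X : measurableType d).
Variable mu : probability X R.
Hypothesis sepX : countably_separated X.
Variable E : cber X.
Variables (G : groupType) (a : pmp_action G mu).
Hypothesis aE : pact_induces a E.

Section ActionElement.
Variable c : G.

Definition pact_fun (x : X) : option X := Some (a c x).

Lemma pact_inj : injective (a c).
Proof.
move=> x y /(congr1 (a c^-1%g)).
by rewrite -!pactM mulVg !pact1.
Qed.

Lemma pact_fun_inj : pinjective pact_fun.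
Proof. by move=> x y z [xz] [yz]; apply: pact_inj; rewrite xz yz. Qed.

Lemma pact_fun_preimage B : measurable B -> measurable (ppreimage pact_fun B).
Proof.
move=> mB; rewrite (_ : ppreimage _ _ = setT `&` a c @^-1` B); first exact: pact_borel.
apply/seteqP; split=> [x [y By [xy]]|x [_ ?]]; last by exists (a c x).
by split=> //; rewrite /preimage/= xy.
Qed.

Lemma pact_fun_imageE A : pimage pact_fun A = a c @` A.
Proof. apply/seteqP; split=> [y [x Ax [xy]]|y [x Ax xy]]; exists x => //.
by rewrite /pact_fun xy. Qed.

Lemma pact_fun_image A : measurable A -> measurable (pimage pact_fun A).
Proof. by move=> mA; rewrite pact_fun_imageE; exact: measurable_pact_image. Qed.

Lemma pact_fun_rel x y : pact_fun x = Some y -> E x y.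
Proof. by move=> [xy]; apply/aE; exists c; rewrite xy. Qed.

Definition fsgB_pact : fsgB E :=
  FsgB pact_fun_inj pact_fun_preimage pact_fun_image pact_fun_rel.

Lemma fsgB_pact_total : fsgB_total fsgB_pact.
Proof.
split; apply/seteqP; split=> // x _.
exists (a c^-1%g x) => /=; rewrite /pact_fun -pactM mulgV pact1//.
Qed.

(** As the group induces the relation, the pieces of [g] cover its domain; a
    partial map is thus known from countably many Borel sets. *)
Definition piece (g : fsgB E) : set X := [set x | g x = Some (a c x)].

Lemma measurable_piece g : measurable (piece g).
Proof.
rewrite (_ : piece g = ~` neqset g fsgB_pact).
  by apply: measurableC; exact: measurable_neqset.
by apply/seteqP; split=> [x gx //|x /contrapT].
Qed.

End ActionElement.

Variable e : nat -> G.
Hypothesis eG : forall c, exists j, e j = c.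

Definition remainder (g : fsgB E) m : set X :=
  pdom g `\` \bigcup_(j in `I_m) piece (e j) g.

Lemma remainder_tail g m : remainder g m = tail (fun j => piece (e j) g) m.
Proof.
congr setD; apply/seteqP; split=> x.
  rewrite /pdom/=; case gx: (g x) => [y|]// _.
  have /aE[c yE] := fsgB_rel gx; have [j ej] := eG c.
  by exists j => //; rewrite /piece/= gx ej yE.
by move=> [j _]; rewrite /piece /pdom/= => ->.
Qed.

Lemma measurable_remainder g m : measurable (remainder g m).
Proof. by rewrite remainder_tail; apply: measurable_tail => j; exact: measurable_piece. Qed.

Lemma mass_remainder g : mass mu (remainder g m) @[m --> \oo] --> 0.
Proof.
under eq_fun do rewrite remainder_tail.
by apply: mass_tail => j; exact: measurable_piece.
Qed.

Lemma not_remainder (g : fsgB E) m x y : g x = Some y -> ~ remainder g m x ->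
  exists2 j, (j < m)%N & y = a (e j) x.
Proof.
move=> gx nr; have [[j jm]|nj] := pselect ((\bigcup_(j in `I_m) piece (e j) g) x).
  by rewrite /piece/= gx => -[->]; exists j.
by case: nr; split=> //; rewrite /pdom/= gx.
Qed.

Variable B : nat -> set X.
Hypothesis mB : forall s, measurable (B s).
Hypothesis densB : forall A r, measurable A -> 0 < r ->
  exists s, mass mu (A `+` B s) < r.

(** A code lists which sets [B] approximate the first pieces of [g]; there are
    countably many codes, and each determines [g] up to a small error. *)
Definition coded (N : nat) (s : seq nat) (g : fsgB E) : Prop :=
  mass mu (remainder g (size s)) <= N.+1%:R^-1 /\
  forall j, mass mu (piece (e j) g `+` B (nth 0%N s j)) <= (N.+1%:R^-1 / (size s).+1%:R) \/ (size s <= j)%N.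

(** Off the two remainders and the mismatches between pieces and their common
    approximations, both maps act at a point by the same group element. *)
Lemma coded_close N s g h : coded N s g -> coded N s h ->
  dmu mu g h <= 4 / N.+1%:R.
Proof.
move=> [rg pg] [rh ph]; set r : R := N.+1%:R^-1.
have r0 : 0 <= r by rewrite invr_ge0.
pose D f j := (if (j < size s)%N then piece (e j) f `+` B (nth 0%N s j) else set0).
have mD f j : measurable (D f j).
  by rewrite /D; case: ifP => // _; apply: measurableY => //; exact: measurable_piece.
have hD f : coded N s f -> mass mu (\bigcup_(j in `I_(size s)) D f j) <= r.
  move=> [_ pf].
  apply: le_trans (@mass_bigcup _ _ _ mu (D f) (fun=> r / (size s).+1%:R) (size s) _ _) _.
  - exact: mD.
  - move=> j; rewrite /D; case: ltnP => js; last by rewrite mass0 divr_ge0.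
    by have [//|] := pf j; rewrite leqNgt js.
  rewrite sumr_const card_ord -[leLHS]mulr_natr [leLHS]mulrAC ler_pdivrMr ?ltr0n//.
  by rewrite ler_wpM2l// ler_nat.
have mU f : measurable (\bigcup_(j in `I_(size s)) D f j).
  by apply: bigcup_measurable => j _.
have split_mass f : coded N s f ->
    mass mu (remainder f (size s) `|` \bigcup_(j in `I_(size s)) D f j) <= r + r.
  move=> cf; apply: le_trans (massU_le mu _ _) _ => //; first exact: measurable_remainder.
  by apply: lerD; [case: cf|exact: hD].
rewrite dmuE// (_ : 4 / _ = (r + r) + (r + r)); last by rewrite -/r; lra.
apply: le_trans (lerD (split_mass g _) (split_mass h _)) => //.
apply: mass_le2.
- by apply: measurableU => //; exact: measurable_remainder.
- by apply: measurableU => //; exact: measurable_remainder.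
- exact: measurable_neqset.
have key f f' x y : ~ (remainder f (size s) `|` \bigcup_(j in `I_(size s)) D f j) x ->
    ~ (remainder f' (size s) `|` \bigcup_(j in `I_(size s)) D f' j) x ->
    f x = Some y -> f x = f' x.
  move=> /not_orP[nr nD] /not_orP[_ nD'] fx.
  have [j js yE] := not_remainder fx nr.
  have fj : piece (e j) f x by rewrite /piece/= fx yE.
  have Bj : B (nth 0%N s j) x.
    by apply: contrapT => nB; apply: nD; exists j => //; rewrite /D js; left.
  suff -> : f' x = Some (a (e j) x) by [].
  by apply: contrapT => nf'; apply: nD'; exists j => //; rewrite /D js; right.
move=> x gh; apply: contrapT => /not_orP[ng nh]; apply: gh.
case gx: (g x) => [y|]; first by rewrite -gx; exact: key gx.
by case hx: (h x) => [y|]//; rewrite -hx -gx; apply/esym; exact: key hx.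
Qed.

Lemma coded_exists N g : exists s, coded N s g.
Proof.
set r : R := N.+1%:R^-1; have r0 : 0 < r by rewrite invr_gt0.
have [m _ /(_ _ (leqnn m)) rm] : \forall m \near \oo, mass mu (remainder g m) < r.
  by have /cvgr_lt := @mass_remainder g; apply.
have hs j : exists s, mass mu (piece (e j) g `+` B s) < r / m.+1%:R.
  by apply: densB; [exact: measurable_piece|rewrite divr_gt0].
exists (mkseq (fun j => sval (cid (hs j))) m); rewrite /coded size_mkseq; split.
  exact: ltW.
move=> j; case: (ltnP j m) => jm; [left|by right].
by rewrite nth_mkseq// ltW//; exact: (svalP (cid (hs j))).
Qed.

Lemma fsgB_separable : exists D : nat -> fsgB E,
  forall g (r : R), 0 < r -> exists j, dmu mu g (D j) < r.
Proof.
pose pick c : fsgB E := if pselect (exists g, coded c.1 c.2 g) is left h then sval (cid h)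
  else fsgB_id E.
exists (fun j => if unpickle j is Some c then pick c else fsgB_id E) => g r r0.
have r40 : 0 < r / 4 by rewrite divr_gt0.
have [N _ /(_ _ (leqnn N))/= hN] := near_infty_natSinv_lt (PosNum r40).
have [s cs] := coded_exists N g.
exists (pickle (N, s)); rewrite pickleK /pick /=.
case: pselect => [h|[]]; last by exists g.
apply: le_lt_trans (coded_close cs (svalP (cid h))) _.
by rewrite mulrC -ltr_pdivlMr.
Qed.

End Separability.

(** * Asymptotically multiplicative sequences *)

Section SoficApproximation.
Variables (R : realType) (d : measure_display) (X : measurableType d).
Variable mu : probability X R.
Hypothesis sepX : countably_separated X.
Variable E : cber X.
Hypothesis pmpE : measure_preserving mu E.

Definition agree_set (g h : fsgB E) : borel_set X :=
  exist _ (pdom g `\` neqset g h)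
    (measurableD (measurable_pdom g) (measurable_neqset sepX g h)).

Lemma dcount_triangle n (f g h : fsgn n) :
  dcount R f h <= dcount R f g + dcount R g h.
Proof.
rewrite !dcountE; apply: freq_le2 => i fh.
by case: (EM (f i = g i)) => [fg|]; [right; rewrite -fg|left].
Qed.

Lemma dcount_ge0 n (f g : fsgn n) : 0 <= dcount R f g.
Proof. by rewrite dcountE freq_ge0. Qed.

(** An almost multiplicative and trace-preserving map is almost Lipschitz.
    Where the image of the partial identity [I] on the agreement set fixes an
    index, [p g] and [p h] coincide because [g * I] and [h * I] do.  Elsewhere
    [p g] is defined only on the fixed points of the image of the partial
    identity on its domain, and traces bound how many of these [I] misses. *)
Lemma dcount_lipschitz n (p : fsgB E -> fsgn n) (K : set (fsgB E)) (r : R) (g h : fsgB E) :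
  (forall g h : fsgB E, (forall x, g x = h x) -> p g = p h) ->
  (forall g h, K g -> K h -> dcount R (p (fsgB_mul g h)) (fsgn_mul (p g) (p h)) < r) ->
  (forall g, K g -> `|mass mu (fixset g) - fsgn_tr R (p g)| < r) ->
  K g -> K h -> K (fsgB_restr E (dom_set g)) -> K (fsgB_restr E (dom_set h)) ->
  K (fsgB_restr E (agree_set g h)) ->
  dcount R (p g) (p h) <= 2 * dmu mu g h + 10 * r.
Proof.
move=> pext pmul ptr Kg Kh KIg KIh KI.
set I := fsgB_restr E (agree_set g h) in KI *.
pose F := fun i : 'I_n => p I i = Some i.
(* two products and two traces account for the error 4r; the two products with
   I that are used afterwards raise the total to 10r *)
have half (k : fsgB E) : (forall x, sval (agree_set g h) x -> pdom k x) ->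
    mass mu (pdom k) <= mass mu (sval (agree_set g h)) + dmu mu g h ->
    K k -> K (fsgB_restr E (dom_set k)) ->
    freq R (fun i => (p k i <> None) /\ ~ F i) <= dmu mu g h + 4 * r.
  move=> sub mle Kk KIk; set J := fsgB_restr E (dom_set k) in KIk *.
  have e1 : p (fsgB_mul k J) = p k.
    apply: pext => x; rewrite /= /pcomp /J.
    have [kx|kx] := pselect (pdom k x).
      by rewrite pid_fun_in.
    by rewrite pid_fun_out//=; move: kx; rewrite /pdom/=; case: (k x).
  have e2 : p (fsgB_mul J I) = p I.
    apply: pext => x; rewrite /= /pcomp /J /I.
    have [Ax|nAx] := pselect (sval (agree_set g h) x).
      by rewrite pid_fun_in//= pid_fun_in//; exact: sub.
    by rewrite pid_fun_out.
  have := pmul k J Kk KIk; rewrite e1 dcountE; set b1 := freq R _ => hb1.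
  have := pmul J I KIk KI; rewrite e2 dcountE; set b2 := freq R _ => hb2.
  have := ptr J KIk; have := ptr I KI; rewrite !fsgn_trE !fixset_restr -/F.
  rewrite (freqDI R (fun i => p J i = Some i) F).
  rewrite !ltr_norml => /andP[_ t1] /andP[t2 _].
  have s1 : freq R (fun i => p k i <> None /\ ~ F i) <=
      b1 + freq R (fun i => p J i = Some i /\ ~ F i).
    apply: freq_le2 => i [ki nF]; apply: contrapT => /not_orP[/contrapT ek nJ].
    apply: nJ; split=> //; case kz: (p k i) ki ek => [z|]// _.
    rewrite ffunE /pcomp; case: (p J i) => [j|]//= /esym kj.
    by congr Some; exact: fsgn_inj kj kz.
  have s2 : freq R F <= freq R (fun i => p J i = Some i /\ F i) + b2.
    apply: freq_le2 => i Fi.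
    have [eJ|] := pselect (p I i = fsgn_mul (p J) (p I) i); last by right.
    left; split=> //; move: eJ; rewrite ffunE /pcomp.
    by have -> : p I i = Some i by [].
  by move: mle t1 t2 => /= mle t1 t2; lra.
have sub_g x : sval (agree_set g h) x -> pdom g x by case.
have sub_h x : sval (agree_set g h) x -> pdom h x.
  by case=> gx /contrapT gh; move: gx; rewrite /pdom/= gh.
have mA := svalP (agree_set g h).
have mN := measurable_neqset sepX g h.
have hg := half g sub_g _ Kg KIg; have hh := half h sub_h _ Kh KIh.
have {}hg : freq R (fun i => p g i <> None /\ ~ F i) <= dmu mu g h + 4 * r.
  apply: hg; rewrite dmuE//; apply: mass_le2 => //; first exact: measurable_pdom.
  by move=> x gx; have [gh|gh] := pselect (g x = h x); [left; split=> //; apply|right].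
have {}hh : freq R (fun i => p h i <> None /\ ~ F i) <= dmu mu g h + 4 * r.
  apply: hh; rewrite dmuE//; apply: mass_le2 => //; first exact: measurable_pdom.
  move=> x hx; have [gh|gh] := pselect (g x = h x); [left|by right].
  by split; [move: hx; rewrite /pdom/= gh|apply].
have e0 : p (fsgB_mul g I) = p (fsgB_mul h I).
  apply: pext => x; rewrite /= /pcomp /I.
  have [Ax|nAx] := pselect (sval (agree_set g h) x).
    by rewrite pid_fun_in//=; case: Ax => _ /contrapT.
  by rewrite pid_fun_out.
have := pmul g I Kg KI; have := pmul h I Kh KI; rewrite e0 !dcountE.
set b1 := freq R _ => hb1; set b2 := freq R _ => hb2.
have : freq R (fun i => p g i <> p h i) <= (b1 + b2) +
   (freq R (fun i => p g i <> None /\ ~ F i) + freq R (fun i => p h i <> None /\ ~ F i)).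
  apply: le_trans (lerD (freqU_le _ _ _) (freqU_le _ _ _)).
  apply: freq_le2 => i ghi; apply: contrapT => /not_orP[/not_orP[/contrapT ph /contrapT pg]].
  move=> /not_orP[ng nh]; apply: ghi.
  case: (EM (F i)) => Fi.
    move: ph; rewrite pg !ffunE /pcomp.
    by have -> : p I i = Some i by [].
  by case: (p g i) ng => [y|ng]; [case; split|case: (p h i) nh => [y []|]//; split].
by move=> ?; lra.
Qed.

Definition sofic_sequence (n : nat -> nat)
    (Pi : forall k, full_semigroup mu E -> fsgn (n k)) : Prop :=
  [/\ forall k, (0 < n k)%N,
      forall q r, dcount R (Pi k (fsg_mul q r)) (fsgn_mul (Pi k q) (Pi k r))
        @[k --> \oo] --> 0
    & forall q, fsgn_tr R (Pi k q) @[k --> \oo] --> fsg_tr q].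

(** Soficity handles finitely many elements at a time.  At stage [k] it is applied
    to the first [k.+1] elements of a dense sequence, their products and the
    partial identities needed for the Lipschitz bound, and an arbitrary element
    is sent to the image of its best approximation among them.  The Lipschitz
    bound makes the choice of approximations harmless in the limit, so that
    one sequence of maps is asymptotically multiplicative and trace-preserving
    on the whole, uncountable, semigroup. *)
Lemma sofic_sequenceP (D : nat -> fsgB E) :
  (forall g (r : R), 0 < r -> exists j, dmu mu g (D j) < r) ->
  sofic mu E -> exists n Pi, @sofic_sequence n Pi.
Proof.
move=> densD sof.
pose S k := [set D j | j in `I_k.+1].
pose S1 k := S k `|` [set fsgB_mul p.1 p.2 | p in S k `*` S k].
pose K k := S1 k `|` [set fsgB_restr E (dom_set g) | g in S1 k]
  `|` [set fsgB_restr E (agree_set p.1 p.2) | p in S1 k `*` S1 k].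
have finS k : finite_set (S k) by apply: finite_image; exact: finite_II.
have finS1 k : finite_set (S1 k).
  by rewrite finite_setU; split => //; apply: finite_image; exact: finite_setX.
have finK k : finite_set (K k).
  rewrite finite_setU; split; last by apply: finite_image; exact: finite_setX.
  by rewrite finite_setU; split => //; exact: finite_image.
pose c (g : fsgB E) : full_semigroup mu E := mcls (dmu mu (E:=E)) g.
pose r k : R := k.+1%:R^-1.
have r0 k : 0 < r k by rewrite invr_gt0.
have sofk k : exists N (pi : full_semigroup mu E -> fsgn N), (0 < N)%N /\
    (forall g h, K k g -> K k h ->
      dcount R (pi (c (fsgB_mul g h))) (fsgn_mul (pi (c g)) (pi (c h))) < r k) /\
    (forall g, K k g -> `|mass mu (fixset g) - fsgn_tr R (pi (c g))| < r k).
  have [N [pi [N0 _ pm pt]]] := sof [set c g | g in K k] (r k) (finite_image _ (finK k)) (r0 k).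
  exists N, pi; split=> //; split=> [g h Kg Kh|g Kg].
    by rewrite /c -fsg_mul_mcls//; apply: pm; [exists g|exists h].
  by rewrite -fsg_tr_mcls//; apply: pt; exists g.
pose n k := sval (cid (sofk k)).
pose pi k := sval (cid (svalP (cid (sofk k)))).
have pi_spec k := svalP (cid (svalP (cid (sofk k)))).
pose best k (g : fsgB E) : fsgB E := D [arg min_(j < ord0 : 'I_k.+1) dmu mu g (D j)]%O.
have bestS k g : S k (best k g) by exists [arg min_(j < ord0 : 'I_k.+1) dmu mu g (D j)]%O => //=.
have best_cvg g : dmu mu g (best k g) @[k --> \oo] --> 0.
  apply/cvgrPdist_lt => eps eps0; have [j hj] := densD g eps eps0.
  exists j => // k /= jk; rewrite sub0r normrN ger0_norm ?dmu_ge0//.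
  apply: le_lt_trans hj; rewrite /best; case: arg_minP => // i _ /(_ (Ordinal (jk : (j < k.+1)%N)))/=.
  by apply.
have rcvg : r k @[k --> \oo] --> 0 by exact: cvg_harmonic.
have lip k g h : S1 k g -> S1 k h ->
    dcount R (pi k (c g)) (pi k (c h)) <= 2 * dmu mu g h + 10 * r k.
  move=> Sg Sh; have [_ [pm pt]] := pi_spec k.
  apply: (@dcount_lipschitz _ (fun g => pi k (c g)) (K k)) => //.
  - by move=> g' h' gh; rewrite /c (mcls_ext mu sepX gh).
  - by left; left.
  - by left; left.
  - by left; right; exists g.
  - by left; right; exists h.
  - by right; exists (g, h).
exists n, (fun k q => pi k (c (best k (mrepr q)))); split.
- by move=> k; have [] := pi_spec k.
- move=> q q'; set g := mrepr q; set h := mrepr q'; set gh := mrepr (fsg_mul q q').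
  have ghE : dmu mu gh (fsgB_mul g h) = 0 by exact: mrepr_dmu.
  pose bound k := 2 * (dmu mu gh (best k gh) + dmu mu g (best k g) + dmu mu h (best k h)) + 11 * r k.
  have bcvg : bound k @[k --> \oo] --> 0.
    rewrite (_ : 0 = 2 * (0 + 0 + 0) + 11 * 0 :> R); last by rewrite !addr0 !mulr0 addr0.
    apply: cvgD; apply: cvgM => //; try exact: cvg_cst.
    by apply: cvgD => //; exact: cvgD.
  apply: (squeeze_cvgr _ (@cvg_cst _ _ _ _ _) bcvg).
  apply: nearW => k; rewrite dcount_ge0 /=.
  apply: le_trans (dcount_triangle _ (pi k (c (fsgB_mul (best k g) (best k h)))) _) _.
  have Sg := bestS k g; have Sh := bestS k h; have Sgh := bestS k gh.
  have [_ [pm pt]] := pi_spec k.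
  have := pm (best k g) (best k h) (or_introl (or_introl (or_introl Sg)))
    (or_introl (or_introl (or_introl Sh))).
  have : dcount R (pi k (c (best k gh))) (pi k (c (fsgB_mul (best k g) (best k h))))
      <= 2 * dmu mu (best k gh) (fsgB_mul (best k g) (best k h)) + 10 * r k.
    by apply: lip; [left|right; exists (best k g, best k h)].
  have := dmu_triangle mu sepX (best k gh) gh (fsgB_mul (best k g) (best k h)).
  have := dmu_triangle mu sepX gh (fsgB_mul g h) (fsgB_mul (best k g) (best k h)).
  have := dmu_mul sepX pmpE g (best k g) h (best k h).
  rewrite ghE (dmuC mu sepX (best k gh) gh) /bound.
  move=> t1 t2 t3 t4 t5; clear -t1 t2 t3 t4 t5.
  move: (r k) (dcount _ _ _) (dcount _ _ _) t4 t5 => *; lra.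
- move=> q; set g := mrepr q.
  have bcvg : dmu mu g (best k g) + r k @[k --> \oo] --> 0.
    by rewrite -[X in _ --> X]addr0; exact: cvgD.
  apply/cvgrPdist_le => eps eps0.
  have /cvgrPdist_le/(_ eps eps0) := bcvg.
  apply: filterS => k; rewrite sub0r normrN ger0_norm; last first.
    by rewrite addr_ge0 ?dmu_ge0// ltW.
  apply: le_trans; have [_ [_ pt]] := pi_spec k.
  have := pt (best k g) (or_introl (or_introl (or_introl (bestS k g)))).
  rewrite /fsg_tr -/(mass mu _) -/g -/(fixset g).
  have := mass_fixset_le mu sepX g (best k g).
  have := mass_fixset_le mu sepX (best k g) g.
  rewrite (dmuC mu sepX (best k g) g) => h1 h2.
  rewrite ltr_norml ler_norml => /andP[h3 h4].
  by clear -h1 h2 h3 h4; move: (fsgn_tr _ _) h3 h4 => *; apply/andP; split; lra.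
Qed.

End SoficApproximation.

(** * Operations on ultraproducts *)

Section UltraproductOperations.
Variables (R : realType) (U : set_system nat).
Context {UU : UltraFilter U}.
Variables (n : nat -> nat) (n0 : forall k, (0 < n k)%N).
Implicit Types (s t : forall k, 'S_(n k)) (A B : forall k, {set 'I_(n k)}).

Definition uperm_cls s : uperm R U n := mcls _ s.
Definition uMAlg_cls A : uMAlg R U n := mcls _ A.

Lemma uperm_clsP s t :
  uperm_cls s = uperm_cls t <-> ae R U (fun k i => s k i = t k i).
Proof. exact: (mcls_ulim n0 (fun k (x y : 'S_(n k)) => dpermE R x y)). Qed.

Lemma uMAlg_clsP A B :
  uMAlg_cls A = uMAlg_cls B <-> ae R U (fun k i => (i \in A k) = (i \in B k)).
Proof. exact: (mcls_ulim n0 (fun k (x y : {set 'I_(n k)}) => dMAlgnE R x y)). Qed.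

Lemma mrepr_uperm s : ae R U (fun k i => mrepr (uperm_cls s) k i = s k i).
Proof. by apply/uperm_clsP; exact: mreprK. Qed.

Lemma mrepr_uMAlg A : ae R U (fun k i => (i \in mrepr (uMAlg_cls A) k) = (i \in A k)).
Proof. by apply/uMAlg_clsP; exact: mreprK. Qed.

Lemma tends_uperm_dist (p q : uperm R U n) :
  tends U (fun k i => mrepr p k i <> mrepr q k i) (Defs.mdist p q).
Proof.
exact: (tends_ulim n0 (fun k (x y : 'S_(n k)) => dpermE R x y) (x := mrepr p) (y := mrepr q)).
Qed.

Lemma tends_uMAlg_dist (p q : uMAlg R U n) :
  tends U (fun k i => (i \in mrepr p k) <> (i \in mrepr q k)) (Defs.mdist p q).
Proof.
exact: (tends_ulim n0 (fun k (x y : {set 'I_(n k)}) => dMAlgnE R x y) (x := mrepr p) (y := mrepr q)).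
Qed.

Lemma uperm_dist_cls s t (c : R) :
  tends U (fun k i => s k i <> t k i) c -> Defs.mdist (uperm_cls s) (uperm_cls t) = c.
Proof.
move=> st; apply: (tends_unique (@tends_uperm_dist _ _)).
by apply: tends_ae st; apply: aeS2 (mrepr_uperm s) (mrepr_uperm t) => k i -> ->.
Qed.

Lemma uMAlg_dist_cls A B (c : R) :
  tends U (fun k i => (i \in A k) <> (i \in B k)) c ->
  Defs.mdist (uMAlg_cls A) (uMAlg_cls B) = c.
Proof.
move=> AB; apply: (tends_unique (@tends_uMAlg_dist _ _)).
by apply: tends_ae AB; apply: aeS2 (mrepr_uMAlg A) (mrepr_uMAlg B) => k i -> ->.
Qed.

Lemma tends_uperm_tr (p : uperm R U n) :
  tends U (fun k i => mrepr p k i = i) (uperm_tr p).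
Proof. by apply: tends_lim => // k; exact: perm_trE. Qed.

Lemma uperm_mul_cls s t :
  uperm_mul (uperm_cls s) (uperm_cls t) = uperm_cls (fun k => perm_comp (s k) (t k)).
Proof.
apply/uperm_clsP; have hs := mrepr_uperm s; have ht := mrepr_uperm t.
apply: aeS2 (ae_perm t hs) ht => k i h1 h2.
by rewrite /perm_comp !permM h2.
Qed.

Lemma uMAlg_cap_cls A B :
  uMAlg_cap (uMAlg_cls A) (uMAlg_cls B) = uMAlg_cls (fun k => A k :&: B k)%SET.
Proof.
apply/uMAlg_clsP; apply: aeS2 (mrepr_uMAlg A) (mrepr_uMAlg B) => k i h1 h2.
by rewrite !finset.in_setI h1 h2.
Qed.

Lemma uperm_act_cls s A :
  uperm_act (uperm_cls s) (uMAlg_cls A) = uMAlg_cls (fun k => s k @: A k)%SET.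
Proof.
apply/uMAlg_clsP; apply: (ae_permV (s := s)).
apply: aeS2 (mrepr_uperm s) (mrepr_uMAlg A) => k i h1 h2.
rewrite [RHS]mem_imset; last exact: perm_inj.
by rewrite -[in LHS]h1 mem_imset//; exact: perm_inj.
Qed.

Lemma uperm_reprK (p : uperm R U n) : uperm_cls (mrepr p) = p.
Proof. exact: mreprK. Qed.

End UltraproductOperations.

(** A permutation that agrees with a partial injection [g] at as many points as
    possible agrees with it wherever [g] is defined: at a point of disagreement,
    composing with a transposition would gain that point and lose none. *)
Lemma fsgn_extend n (g : fsgn n) :
  exists s : 'S_n, forall i y, g i = Some y -> s i = y.
Proof.
pose agr (s : 'S_n) := [set i | g i == Some (s i)]%SET.
have [s _ smax] : {s : 'S_n | true & forall t, (#|agr t| <= #|agr s|)%N}.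
  case: (@arg_maxnP _ (1%g : 'S_n) xpredT (fun s : 'S_n => #|agr s|)) => // s _ h.
  by exists s => // t; exact: h.
exists s => i y giy; apply: contrapT => siy.
pose t := (s * tperm (s i) y)%g.
suff : (#|agr s| < #|agr t|)%N by rewrite ltnNge smax.
apply: proper_card; apply/properP; split.
  apply/fintype.subsetP => j; rewrite !finset.in_set permM => /eqP gj.
  have ji : s i != s j.
    apply/eqP => /perm_inj ij; apply: siy.
    by move: gj; rewrite -ij giy => -[->].
  rewrite tpermD ?gj//; apply/eqP => yj; move/eqP: ji; apply.
  by congr (s _); apply: (fsgn_inj giy); rewrite gj yj.
exists i; rewrite finset.in_set ?permM ?tpermL ?giy//.
by apply/eqP => -[] /esym.
Qed.

(** * Embeddings given by an asymptotically multiplicative sequence *)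

Section SoficEmbedding.
Variables (R : realType) (d : measure_display) (X : measurableType d).
Variable mu : probability X R.
Hypothesis sepX : countably_separated X.
Variable E : cber X.
Hypothesis pmpE : measure_preserving mu E.
Variables (n : nat -> nat) (Pi : forall k, full_semigroup mu E -> fsgn (n k)).
Hypothesis sofPi : sofic_sequence Pi.
Variable U : set_system nat.
Context {UU : UltraFilter U}.
Hypothesis Uoo : forall P, (\forall k \near \oo, P k) -> U P.

Local Notation cls g := (mcls (@dmu R d X mu E) g : full_semigroup mu E).

Let n0 : forall k, (0 < n k)%N.
Proof. by case: sofPi. Qed.

Lemma cvg_free (f : nat -> R) (c : R) : f k @[k --> \oo] --> c -> f k @[k --> U] --> c.
Proof. by move=> fc N /fc; exact: Uoo. Qed.

Lemma Pi_mul g h : ae R U (fun k i =>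
  Pi k (cls (fsgB_mul g h)) i = pcomp (Pi k (cls g)) (Pi k (cls h)) i).
Proof.
have [_ /(_ (cls g) (cls h))/cvg_free hm _] := sofPi.
rewrite /ae /tends; move: hm; rewrite fsg_mul_mcls//.
apply: cvg_trans; apply: near_eq_cvg; apply: nearW => k.
by rewrite dcountE; apply: eq_freq => i; rewrite ffunE.
Qed.

Lemma Pi_tr g : tends U (fun k i => Pi k (cls g) i = Some i) (mass mu (fixset g)).
Proof.
have [_ _ /(_ (cls g))/cvg_free] := sofPi; rewrite fsg_tr_mcls//.
apply: cvg_trans; apply: near_eq_cvg; apply: nearW => k.
by rewrite fsgn_trE.
Qed.

Lemma Pi_id (g : fsgB E) : (forall x, g x = Some x) -> ae R U (fun k i => Pi k (cls g) i = Some i).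
Proof.
move=> gid; apply/tends1_ae => //.
rewrite -(massT mu) -(_ : fixset g = setT); [exact: Pi_tr|].
by apply/seteqP; split=> // x _; exact: gid.
Qed.

(** The image of a full-group element is nearly a permutation, and is replaced
    by a permutation extending it. *)
Definition Pi_perm k (q : full_semigroup mu E) : 'S_(n k) :=
  sval (cid (fsgn_extend (Pi k q))).

(** As the composite of [g] with its inverse is the identity, its image fixes
    almost every index, where the image of [g] must then be defined. *)
Lemma Pi_total g : fsgB_total g ->
  ae R U (fun k i => Pi k (cls g) i = Some (Pi_perm k (cls g) i)).
Proof.
move=> tg; have := Pi_id (fun x => total_mul_inv x tg).
apply: aeS2 (Pi_mul (fsgB_inv g) g) => k i ->; rewrite /pcomp.
case gi: (Pi k (cls g) i) => [y|]//= _; congr Some.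
by rewrite /Pi_perm; case: cid => s /= hs; rewrite (hs _ _ gi).
Qed.

Lemma Pi_perm_mul g h : fsgB_total g -> fsgB_total h ->
  ae R U (fun k i => Pi_perm k (cls (fsgB_mul g h)) i =
    Pi_perm k (cls g) (Pi_perm k (cls h) i)).
Proof.
move=> tg th; have h1 := ae_perm (fun k => Pi_perm k (cls h)) (Pi_total tg).
have h2 := Pi_total (fsgB_total_mul tg th).
apply: aeS2 (aeI (Pi_mul g h) h1) (aeI h2 (Pi_total th)) => k i [-> e1] [+ e2].
by rewrite /pcomp e2 /= e1 => -[].
Qed.

(** The permutations of [g] and [h] agree at the indices fixed by the image of
    the inverse of [h] composed with [g], whose frequency is a trace. *)
Lemma Pi_perm_dist g h : fsgB_total g -> fsgB_total h ->
  tends U (fun k i => Pi_perm k (cls g) i <> Pi_perm k (cls h) i) (dmu mu g h).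
Proof.
move=> tg th.
have agr : mass mu (fixset (fsgB_mul (fsgB_inv h) g)) = 1 - dmu mu g h.
  rewrite dmuE// -massC; last exact: measurable_neqset.
  congr mass; apply/seteqP; split=> x; rewrite /fixset /neqset/= /pcomp.
    by case: (g x) => [y|]//= /pinv_funP ->; apply.
  by move=> /contrapT ->; exact: (total_mul_inv x th).
suff h1 : tends U (fun k i => Pi_perm k (cls g) i = Pi_perm k (cls h) i) (1 - dmu mu g h).
  by rewrite -[X in tends _ _ X](subKr 1); exact: (tendsC n0 h1).
rewrite -agr; apply: tends_ae (@Pi_tr (fsgB_mul (fsgB_inv h) g)).
have hinv := Pi_id (fun x => total_mul_inv x th).
apply: aeS2 (aeI (Pi_total tg) (Pi_total th))
  (aeI (aeI (Pi_mul (fsgB_inv h) g) (Pi_mul (fsgB_inv h) h)) hinv).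
move=> k i [gi hi] [[-> ->]]; rewrite /pcomp gi hi /= => hii.
split=> [gii|-> //]; exact: fsgn_inj gii hii.
Qed.

Definition Pi_set k (A : borel_set X) : {set 'I_(n k)} :=
  [set i | Pi k (cls (fsgB_restr E A)) i == Some i]%SET.

(** An idempotent partial injection is a partial identity. *)
Lemma Pi_restr A : ae R U (fun k i => Pi k (cls (fsgB_restr E A)) i =
  if i \in Pi_set k A then Some i else None).
Proof.
have e1 : cls (fsgB_mul (fsgB_restr E A) (fsgB_restr E A)) = cls (fsgB_restr E A).
  apply: mcls_ext => // x; rewrite /= /pcomp.
  case Ax: (pid_fun A x) => [y|]//=.
  by move/pid_funP: (Ax) => [Ax' xy]; rewrite -xy pid_fun_in.
apply: aeS (Pi_mul (fsgB_restr E A) (fsgB_restr E A)) => k i.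
rewrite e1 finset.in_set /pcomp; case Ai: (Pi k _ i) => [j|] //= Aj.
by rewrite -(fsgn_inj Ai (esym Aj)) eqxx.
Qed.

Lemma Pi_set_mass A : tends U (fun k i => i \in Pi_set k A) (mass mu (sval A)).
Proof.
rewrite -(fixset_restr E A); apply: tends_ae (@Pi_tr _).
by apply: ae_true => k i; rewrite finset.in_set; split=> [->|/eqP].
Qed.

Lemma Pi_setI A B : ae R U (fun k i =>
  (i \in Pi_set k (borel_setI A B)) = (i \in Pi_set k A) && (i \in Pi_set k B)).
Proof.
have e1 : cls (fsgB_mul (fsgB_restr E A) (fsgB_restr E B)) =
    cls (fsgB_restr E (borel_setI A B)).
  apply: mcls_ext => // x; rewrite /= /pcomp.
  have [Bx|nBx] := pselect (sval B x); last first.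
    by rewrite [in LHS]pid_fun_out//= pid_fun_out// => -[].
  rewrite [in LHS]pid_fun_in//=; have [Ax|nAx] := pselect (sval A x).
    by rewrite !pid_fun_in.
  by rewrite !pid_fun_out// => -[].
apply: aeS2 (Pi_mul (fsgB_restr E A) (fsgB_restr E B)) (Pi_restr B) => k i.
rewrite e1 /pcomp => h1 h2; rewrite [LHS]finset.in_set h1 h2.
by case: ifP => iB /=; rewrite ?andbT ?andbF// [in RHS]finset.in_set.
Qed.

Lemma tends_setD (P Q : forall k, 'I_(n k) -> bool) (p q r : R) :
  tends U P p -> tends U Q q -> tends U (fun k i => P k i /\ Q k i) r ->
  tends U (fun k i => P k i <> Q k i) (p + q - r - r).
Proof.
move=> hp hq hpq; rewrite /tends [X in X @ _](_ : _ = (fun k =>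
    freq R (fun i => P k i \/ Q k i) - freq R (fun i => P k i /\ Q k i))).
  by apply: cvgB => //; exact: tendsU.
apply/funext => k; apply/esym.
rewrite (freqDI R (fun i => P k i \/ Q k i) (fun i => P k i /\ Q k i)).
rewrite [X in X + _ - _](_ : _ = freq R (fun i => P k i /\ Q k i)); last first.
  by apply: eq_freq => i; split=> [[]//|[Pi1 Qi1]]; split=> //; left.
rewrite addrAC subrr add0r; apply: eq_freq => i.
by case: (P k i); case: (Q k i); split=> //; intuition.
Qed.

Lemma Pi_set_dist A B :
  tends U (fun k i => (i \in Pi_set k A) <> (i \in Pi_set k B)) (dMAlg mu A B).
Proof.
have hAB : tends U (fun k i => i \in Pi_set k A /\ i \in Pi_set k B)
    (mass mu (sval A `&` sval B)).
  apply: tends_ae (@Pi_set_mass (borel_setI A B)); apply: aeS (Pi_setI A B) => k i ->.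
  by split => /andP.
have := tends_setD (@Pi_set_mass A) (@Pi_set_mass B) hAB.
rewrite (_ : _ + _ - _ - _ = dMAlg mu A B)//.
have mA := svalP A; have mB := svalP B.
rewrite /dMAlg -/(mass mu _) setYE.
have := massIU mu mA mB.
have := massIU mu (measurableI _ _ mA mB) (measurableD (measurableU _ _ mA mB) (measurableI _ _ mA mB)).
rewrite setDIK mass0 setDUK; last by move=> x [? ?]; left.
by move=> *; lra.
Qed.

(** Covariance is the semigroup identity between restricting to the image of [A]
    after [g] and restricting to [A] before [g]. *)
Lemma Pi_set_act g A : fsgB_total g ->
  ae R U (fun k i => (Pi_perm k (cls g) i \in Pi_set k (fsgB_act g A)) = (i \in Pi_set k A)).
Proof.
move=> tg.
have e1 : cls (fsgB_mul (fsgB_restr E (fsgB_act g A)) g) = cls (fsgB_mul g (fsgB_restr E A)).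
  apply: mcls_ext => // x; rewrite /= /pcomp.
  have [y gx] := total_fun x tg; rewrite gx /=.
  have [Ax|nAx] := pselect (sval A x).
    by rewrite [in RHS]pid_fun_in//= gx pid_fun_in//; exists x.
  rewrite [in RHS]pid_fun_out//= pid_fun_out// => -[x' Ax' gx'].
  by apply: nAx; rewrite -(fsgB_inj gx' gx).
have h1 := Pi_mul (fsgB_restr E (fsgB_act g A)) g.
have h2 := Pi_mul g (fsgB_restr E A).
have h3 := ae_perm (fun k => Pi_perm k (cls g)) (Pi_restr (fsgB_act g A)).
apply: aeS2 (aeI h1 h2) (aeI (Pi_total tg) (aeI (Pi_restr A) h3)).
move=> k i [+ +] [gi [Ai gAi]]; rewrite e1 => -> /esym; rewrite /pcomp gi /= gAi Ai.
by case: ifP => _; case: ifP => _ //=; rewrite gi.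
Qed.

Lemma Pi_set_null A B : dMAlg mu A B = 0 ->
  ae R U (fun k i => (i \in Pi_set k A) = (i \in Pi_set k B)).
Proof. by move=> AB; rewrite /ae -AB; exact: Pi_set_dist. Qed.

Definition theta_sofic (q : full_group mu E) : uperm R U n :=
  uperm_cls R U (fun k => Pi_perm k (sval q)).

Definition phi_sofic (M : MAlg mu) : uMAlg R U n :=
  uMAlg_cls R U (fun k => Pi_set k (mrepr M)).

Lemma fg_distE (q r : full_group mu E) : fg_dist q r = dmu mu (fg_repr q) (fg_repr r).
Proof. by rewrite /fg_dist -!fg_reprK fsg_dist_mcls. Qed.

Lemma theta_sofic_embedding : full_group_embedding theta_sofic.
Proof.
have iso : isometric (@fg_dist R d X mu E) (@Defs.mdist R _ _) theta_sofic.
  move=> q r; rewrite fg_distE; apply: uperm_dist_cls => //.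
  have := Pi_perm_dist (fg_repr_total q) (fg_repr_total r).
  by rewrite !fg_reprK.
split=> //.
- move=> q r qr; have := iso q r; rewrite qr iso.
  rewrite !fg_distE dmu_xx// => /esym/(mcls_dmu mu sepX).
  rewrite !fg_reprK; case: q r {qr} => [q hq] [r hr] /= qr.
  exact: eq_exist.
- move=> q r; rewrite uperm_mul_cls//; apply/uperm_clsP => //.
  have := Pi_perm_mul (fg_repr_total q) (fg_repr_total r).
  by rewrite !fg_reprK; apply: aeS => k i ->; rewrite /perm_comp permM.
Qed.

Lemma phi_sofic_embedding : MAlg_embedding phi_sofic.
Proof.
have iso : isometric (@Defs.mdist R _ (dMAlg mu)) (@Defs.mdist R _ _) phi_sofic.
  by move=> M N; apply: uMAlg_dist_cls => //; exact: Pi_set_dist.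
split=> //.
- move=> M N MN; have := iso M N; rewrite MN iso /Defs.mdist dMAlg_xx.
  by move=> /esym/mcls_MAlg; rewrite !mreprK.
- move=> M N; rewrite uMAlg_cap_cls//; apply/uMAlg_clsP => //.
  apply: aeS2 (Pi_set_null (mrepr_MAlg mu (borel_setI (mrepr M) (mrepr N))))
    (Pi_setI (mrepr M) (mrepr N)) => k i.
  by rewrite finset.in_setI => -> ->.
Qed.

Lemma sofic_covariant :
  covariant (@fg_act R d X mu E) (@uperm_act R U n) theta_sofic phi_sofic.
Proof.
move=> q M; rewrite uperm_act_cls//; apply/uMAlg_clsP => //.
apply: (ae_permV (s := fun k => Pi_perm k (sval q))).
have h1 := Pi_set_act (mrepr M) (fg_repr_total q).
have h2 := ae_perm (fun k => Pi_perm k (sval q))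
  (Pi_set_null (mrepr_MAlg mu (fsgB_act (fg_repr q) (mrepr M)))).
rewrite fg_reprK in h1.
apply: aeS2 h1 h2 => k i h1 h2; rewrite h2 h1 mem_imset//; exact: perm_inj.
Qed.

End SoficEmbedding.

(** * Restriction of a covariant pair to the acting group *)

Section FullGroupToGroup.
Variables (R : realType) (d : measure_display) (X : measurableType d).
Variable mu : probability X R.
Hypothesis sepX : countably_separated X.
Variable E : cber X.
Hypothesis pmpE : measure_preserving mu E.
Variables (G : groupType) (a : pmp_action G mu).
Hypothesis aE : pact_induces a E.
Variables (U : set_system nat) (n : nat -> nat).
Context {UU : UltraFilter U}.
Hypothesis n0 : forall k, (0 < n k)%N.
Variables (theta : full_group mu E -> uperm R U n) (phi : MAlg mu -> uMAlg R U n).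
Hypothesis theta_emb : full_group_embedding theta.
Hypothesis theta_phi : covariant (@fg_act R d X mu E) (@uperm_act R U n) theta phi.

Definition fg_pact (c : G) : full_group mu E :=
  exist _ (mcls (@dmu R d X mu E) (fsgB_pact aE c))
    (ex_intro2 _ _ (fsgB_pact aE c) (fsgB_pact_total aE c) erefl).

Lemma fg_repr_pact c : dmu mu (fg_repr (fg_pact c)) (fsgB_pact aE c) = 0.
Proof. by apply/mcls_dmu => //; exact: fg_reprK. Qed.

Lemma fg_pactM c c' : fg_pact (c * c')%g = fg_mul (fg_pact c) (fg_pact c').
Proof.
apply: eq_exist; rewrite -[RHS]fsg_mul_mcls// !fg_reprK /= fsg_mul_mcls//.
by apply: mcls_ext => // x; rewrite /= /pact_fun pactM.
Qed.

Lemma idem_uperm (p : uperm R U n) :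
  uperm_mul p p = p -> ae R U (fun k i => mrepr p k i = i).
Proof.
rewrite -[p]uperm_reprK uperm_mul_cls// => /(uperm_clsP R n0) h.
apply: aeS2 (mrepr_uperm n0 (mrepr p)) h => k i ->.
by rewrite /perm_comp permM => /perm_inj.
Qed.

(** The trace is 1 minus the distance to the identity, and an isometric
    homomorphism preserves this distance. *)
Lemma fg_pact_tr c : uperm_tr (theta (fg_pact c)) = pact_tr a c.
Proof.
have [_ theta_mul iso] := theta_emb.
have id1 : ae R U (fun k i => mrepr (theta (fg_pact 1%g)) k i = i).
  by apply: idem_uperm; rewrite -theta_mul -fg_pactM mulg1.
have h : tends U (fun k i => mrepr (theta (fg_pact c)) k i <> i)
    (fg_dist (fg_pact c) (fg_pact 1%g)).
  rewrite -iso; apply: tends_ae (tends_uperm_dist n0 (p := _) (q := _)).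
  by apply: aeS id1 => k i ->.
have tr1 : uperm_tr (theta (fg_pact c)) = 1 - fg_dist (fg_pact c) (fg_pact 1%g).
  apply: tends_unique (tends_uperm_tr n0 (p := _)) _.
  by apply: tends_ae (tendsC n0 h); apply: ae_true => k i; split=> [/contrapT|? []].
rewrite tr1 /fg_dist fsg_dist_mcls// dmuE//.
rewrite -massC; last exact: measurable_neqset.
rewrite /pact_tr -/(mass mu _); congr mass; apply/seteqP.
split=> x; rewrite /neqset/= /pact_fun pact1.
  by move=> /contrapT [].
by move=> -> [].
Qed.

Lemma fg_pact_covariant :
  covariant (pact_MAlg a) (@uperm_act R U n) (theta \o fg_pact) phi.
Proof.
move=> c M; rewrite /= -theta_phi; congr phi.
apply/mcls_MAlg/eqP; rewrite eq_le dMAlg_ge0 andbT.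
have := dMAlg_act sepX pmpE (fg_repr (fg_pact c)) (fsgB_pact aE c) (mrepr M).
rewrite fg_repr_pact addr0; apply: le_trans.
rewrite dMAlgC /dMAlg /= pact_fun_imageE//.
Qed.

Lemma fg_pact_hom : uperm_hom (theta \o fg_pact).
Proof. by have [_ theta_mul _] := theta_emb; move=> c c' /=; rewrite fg_pactM theta_mul. Qed.

End FullGroupToGroup.

(** * Models of a group action *)

Section CovariantModel.
Variables (R : realType) (d : measure_display) (X : measurableType d).
Variable mu : probability X R.
Variables (G : groupType) (a : pmp_action G mu).
Variables (U : set_system nat) (n : nat -> nat).
Context {UU : UltraFilter U}.
Hypothesis n0 : forall k, (0 < n k)%N.

(** What a covariant pair becomes once representing sequences are chosen: each
    law holds at almost every index. *)
Record covariant_model (s : G -> forall k, 'S_(n k))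
    (cset : borel_set X -> forall k, {set 'I_(n k)}) : Prop := CovariantModel {
  model_mul : forall c c', ae R U (fun k i => s (c * c')%g k i = s c k (s c' k i));
  model_cap : forall A B, ae R U (fun k i =>
    (i \in cset (borel_setI A B) k) = (i \in cset A k) && (i \in cset B k));
  model_mass : forall A, tends U (fun k i => i \in cset A k) (mass mu (sval A));
  model_act : forall c A, ae R U (fun k i =>
    (s c k i \in cset (pact_set a c A) k) = (i \in cset A k)) }.

Arguments model_mass {s cset} _ _.

Lemma borel_set_eq (A B : borel_set X) : sval A = sval B -> A = B.
Proof. by case: A B => [A hA] [B hB] /= AB; exact: eq_exist. Qed.

Lemma tendsDI (P Q : forall k, 'I_(n k) -> Prop) (p q : R) :
  tends U (fun k i => P k i /\ Q k i) p ->
  tends U (fun k i => P k i /\ ~ Q k i) q -> tends U P (p + q).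
Proof.
move=> hp hq; rewrite /tends [X in X @ _](_ : _ = (fun k =>
    freq R (fun i => P k i /\ Q k i) + freq R (fun i => P k i /\ ~ Q k i))).
  exact: cvgD.
by apply/funext => k; rewrite -freqDI.
Qed.

(** Nested events of the same limit frequency coincide almost everywhere. *)
Lemma ae_sub_eq (P Q : forall k, 'I_(n k) -> Prop) (c : R) :
  ae R U (fun k i => P k i -> Q k i) -> tends U P c -> tends U Q c ->
  ae R U (fun k i => P k i <-> Q k i).
Proof.
move=> PQ hP hQ; have hQP : tends U (fun k i => Q k i /\ P k i) c.
  by apply: tends_ae hP; apply: aeS PQ => k i pq; split=> [Pi|[]//]; split=> //; exact: pq.
have [v hv] := ultra_tends R n0 (fun k i => Q k i /\ ~ P k i).
have cv : c = c + v by exact: tends_unique hQ (tendsDI hQP hv).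
have v0 : v = 0 by apply: (@addrI _ c); rewrite addr0 -cv.
move: hv; rewrite v0 => /tends0_ae; apply: aeS2 PQ => k i pq nqp.
split=> // Qi; apply: contrapT => nP; exact: nqp.
Qed.

Section FromEmbedding.
Variables (theta : G -> uperm R U n) (phi : MAlg mu -> uMAlg R U n).
Hypothesis hom : uperm_hom theta.
Hypothesis emb : MAlg_embedding phi.
Hypothesis cov : covariant (pact_MAlg a) (@uperm_act R U n) theta phi.

Lemma MAlg_dist_mcls (A B : borel_set X) :
  Defs.mdist (mcls (dMAlg mu) A) (mcls (dMAlg mu) B) = dMAlg mu A B.
Proof.
rewrite /Defs.mdist; set A' := mrepr _; set B' := mrepr _.
have A0 : dMAlg mu A' A = 0 by exact: mrepr_MAlg.
have B0 : dMAlg mu B' B = 0 by exact: mrepr_MAlg.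
have := (dMAlgC mu A A', dMAlgC mu B B', dMAlg_triangle mu A' A B',
  dMAlg_triangle mu A B B', dMAlg_triangle mu A A' B, dMAlg_triangle mu A' B' B).
by move=> [[[[[]]]]] *; lra.
Qed.

Let s c k := mrepr (theta c) k.
Let cset A k := mrepr (phi (mcls (dMAlg mu) A)) k.

Let csetE A : phi (mcls (dMAlg mu) A) = uMAlg_cls R U (cset A).
Proof. exact/esym/mreprK. Qed.

Let sE c : theta c = uperm_cls R U (s c).
Proof. exact/esym/mreprK. Qed.

Let cset_cap A B : ae R U (fun k i =>
  (i \in cset (borel_setI A B) k) = (i \in cset A k) && (i \in cset B k)).
Proof.
have [_ capE _] := emb; have := capE (mcls (dMAlg mu) A) (mcls (dMAlg mu) B).
rewrite MAlg_cap_mcls !csetE uMAlg_cap_cls// => /(uMAlg_clsP R n0).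
by apply: aeS => k i ->; rewrite finset.in_setI.
Qed.

Let cset_dist A B :
  tends U (fun k i => (i \in cset A k) <> (i \in cset B k)) (dMAlg mu A B).
Proof.
have [_ _ iso] := emb; rewrite -MAlg_dist_mcls -iso.
exact: (tends_uMAlg_dist n0 (p := phi _) (q := phi _)).
Qed.

(** An isometry preserving intersections preserves measures: [phi set0] is
    contained in every [phi A], hence [phi A] weighs [mu A] more than
    [phi set0], and taking the whole space for [A] leaves no room for
    [phi set0]. *)
Let cset_mass A : tends U (fun k i => i \in cset A k) (mass mu (sval A)).
Proof.
pose O : borel_set X := exist _ set0 measurable0.
have [v hv] := ultra_tends R n0 (fun k i => i \in cset O k).
have OA B : ae R U (fun k i => i \in cset O k -> i \in cset B k).
  have -> : cset O = cset (borel_setI O B).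
    by congr cset; apply: borel_set_eq; rewrite /= set0I.
  by apply: aeS (cset_cap O B) => k i -> /andP[].
have hB B : tends U (fun k i => i \in cset B k) (v + mass mu (sval B)).
  apply: (tendsDI (Q := fun k i => i \in cset O k)).
    by apply: tends_ae hv; apply: aeS (OA B) => k i h; split=> [iO|[]//]; split=> //; exact: h.
  have -> : mass mu (sval B) = dMAlg mu B O by rewrite /dMAlg setY0.
  apply: tends_ae (@cset_dist B O); apply: aeS (OA B) => k i.
  by case: (i \in cset B k); case: (i \in cset O k) => /= h; (try by have := h isT);
    split=> //; intuition.
have /andP[_ v1] : 0 <= v + 1 <= 1.
  by rewrite -[X in v + X](massT mu); exact: (tends_bounds n0 (hB (exist _ setT measurableT))).
have /andP[v0 _] : 0 <= v <= 1 by exact: (tends_bounds n0 hv).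
have {}v0 : v = 0 by apply/eqP; rewrite eq_le v0 andbT -(lerD2r 1) add0r.
by have := hB A; rewrite v0 add0r.
Qed.

Lemma embedding_model : covariant_model s cset.
Proof.
split; [|exact: cset_cap|exact: cset_mass|].
- move=> c c'; have := hom c c'; rewrite !sE uperm_mul_cls// => /(uperm_clsP R n0).
  by apply: aeS => k i ->; rewrite /perm_comp permM.
- move=> c A; have := cov c (mcls (dMAlg mu) A).
  have -> : pact_MAlg a c (mcls (dMAlg mu) A) = mcls (dMAlg mu) (pact_set a c A).
    apply/mcls_MAlg; rewrite -[RHS](mrepr_MAlg mu A) /dMAlg.
    rewrite -/(mass mu _) -/(mass mu _) /=.
    rewrite -[in RHS](_ : mass mu (a c @` (sval (mrepr (mcls (dMAlg mu) A)) `+` sval A)) = mass mu (sval (mrepr (mcls (dMAlg mu) A)) `+` sval A)); last first.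
      by rewrite /mass pact_pres//; exact: measurableY (svalP _) (svalP _).
    congr mass; apply/seteqP; split=> y.
      move=> [] [[x Ax <-] nA]; exists x => //; [left|right]; split=> // Bx;
        by apply: nA; exists x.
    move=> [x [] [Ax nBx] <-]; [left|right]; split; try (by exists x);
      by move=> [x' Bx' /pact_inj xx']; apply: nBx; rewrite -xx'.
  rewrite sE !csetE uperm_act_cls// => /(uMAlg_clsP R n0)/(ae_perm (s c)).
  by apply: aeS => k i ->; rewrite mem_imset//; exact: perm_inj.
Qed.

End FromEmbedding.

Section Realization.
Variables (s : G -> forall k, 'S_(n k)) (cset : borel_set X -> forall k, {set 'I_(n k)}).
Hypothesis model : covariant_model s cset.

Definition borelD (A B : borel_set X) : borel_set X :=
  exist _ (sval A `\` sval B) (measurableD (svalP A) (svalP B)).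

Lemma cset_null A : mass mu (sval A) = 0 -> ae R U (fun k i => i \notin cset A k).
Proof.
move=> A0; have := model_mass model A; rewrite A0 => /tends0_ae.
by apply: aeS => k i /negP.
Qed.

Lemma cset_full A : mass mu (sval A) = 1 -> ae R U (fun k i => i \in cset A k).
Proof.
by move=> A1; have := model_mass model A; rewrite A1 => /(tends1_ae R n0).
Qed.

(** Only intersections are preserved by hypothesis; differences follow by
    counting, as the image of the difference fits inside the difference of the
    images and has the same frequency. *)
Lemma csetD A B : ae R U (fun k i =>
  (i \in cset (borelD A B) k) <-> i \in cset A k /\ i \notin cset B k).
Proof.
have mA := svalP A; have mB := svalP B.
have disj : ae R U (fun k i => i \notin cset (borel_setI (borelD A B) B) k).
  by apply: cset_null; rewrite /= setDE -setIA setICl setI0 mass0.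
have incl : borel_setI (borelD A B) A = borelD A B.
  by apply: borel_set_eq; apply/seteqP; split=> x [] // Ax nBx.
have capAB : tends U (fun k i => i \in cset A k /\ i \in cset B k)
    (mass mu (sval A `&` sval B)).
  apply: tends_ae (model_mass model (borel_setI A B)).
  by apply: aeS (model_cap model A B) => k i ->; split=> /andP.
have [v hv] := ultra_tends R n0 (fun k i => i \in cset A k /\ ~ i \in cset B k).
have vE : v = mass mu (sval A `\` sval B).
  have e1 : mass mu (sval A) = mass mu (sval A `&` sval B) + v.
    exact: tends_unique (model_mass model A) (tendsDI capAB hv).
  have := massIU mu (measurableI _ _ mA mB) (measurableD mA mB).
  rewrite (_ : _ `&` _ `&` _ = set0); last by apply/seteqP; split=> // x [[_ ?] []].
  rewrite (_ : _ `&` _ `|` _ = sval A) ?mass0; last first.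
    apply/seteqP; split=> [x [[]//|[]//]|x Ax].
    by have [Bx|nBx] := pselect (sval B x); [left|right].
  by rewrite e1 => e2; lra.
have hsub : ae R U (fun k i => i \in cset (borelD A B) k ->
    i \in cset A k /\ ~ i \in cset B k).
  apply: aeS2 (aeI disj (model_cap model (borelD A B) B))
    (model_cap model (borelD A B) A) => k i [d1 e1].
  rewrite incl => e2 iD; move: (iD); rewrite e2 => /andP[_ iA]; split=> // iB.
  by move: d1; rewrite e1 iD iB.
rewrite vE in hv.
have := ae_sub_eq hsub (model_mass model (borelD A B)) hv.
by apply: aeS => k i ->; split=> -[iA /negP].
Qed.

(** Almost every index of the model has the same membership pattern, with
    respect to finitely many given Borel sets, as some point of the space: an
    empty cell of the partition that they generate has a negligible image. *)
Lemma realize_sets (I : finType) (F : I -> borel_set X) :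
  ae R U (fun k i => exists x, forall j, (i \in cset (F j) k) <-> sval (F j) x).
Proof.
have step (l : seq I) : forall C, ae R U (fun k i => i \in cset C k ->
    exists2 x, sval C x & forall j, j \in l -> (i \in cset (F j) k) <-> sval (F j) x).
  elim: l => [|j l ih] C.
    have [[x Cx]|nC] := pselect (exists x, sval C x).
      by apply: ae_true => k i _; exists x.
    have /cset_null : mass mu (sval C) = 0.
      by rewrite (_ : sval C = set0) ?mass0//; apply/seteqP; split=> // x Cx; apply: nC; exists x.
    by apply: aeS => k i /negP.
  apply: aeS2 (aeI (ih (borel_setI C (F j))) (ih (borelD C (F j))))
    (aeI (model_cap model C (F j)) (csetD C (F j))) => k i [h1 h2] [c1 c2] iC.
  have [iF|/negP iF] := boolP (i \in cset (F j) k).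
    have [|x [Cx Fx] hx] := h1; first by rewrite c1 iC iF.
    by exists x => // j'; rewrite inE => /predU1P[->//|/hx].
  have [|x [Cx Fx] hx] := h2; first by apply/c2; split=> //; apply/negP.
  by exists x => // j'; rewrite inE => /predU1P[->//|/hx].
have hT := cset_full (A := exist _ setT measurableT) (massT mu).
apply: aeS2 hT (step (enum I) (exist _ setT measurableT)) => k i iT /(_ iT)[x _ hx].
by exists x => j; apply: hx; rewrite mem_enum.
Qed.

Definition preset (c : G) (A : borel_set X) : borel_set X :=
  exist _ (setT `&` a c @^-1` sval A) (pact_borel a c measurableT (svalP A)).

Lemma cset_preset c A : ae R U (fun k i =>
  (s c k i \in cset A k) = (i \in cset (preset c A) k)).
Proof.
have e1 : pact_set a c (preset c A) = A.
  apply: borel_set_eq; apply/seteqP; split=> [_ [x [_ Ax] <-]//|x Ax] /=.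
  exists (a c^-1%g x); last by rewrite -pactM mulgV pact1.
  by split=> //; rewrite /preimage/= -pactM mulgV pact1.
by have := model_act model c (preset c A); rewrite e1.
Qed.

Lemma s_one : ae R U (fun k i => s 1%g k i = i).
Proof.
have := model_mul model 1%g 1%g; rewrite mulg1.
by apply: aeS => k i /perm_inj.
Qed.

Variable B : nat -> set X.
Hypothesis mB : forall j, measurable (B j).
Hypothesis sepB : forall x y, (forall j, B j x <-> B j y) -> x = y.

Lemma measurable_pact_fix c : measurable [set x | a c x = x].
Proof.
rewrite (_ : [set x | _] = ~` (\bigcup_j (B j `+` (setT `&` a c @^-1` B j)))).
  apply: measurableC; apply: bigcup_measurable => j _; apply: measurableY => //.
  exact: pact_borel.
apply/seteqP; split=> x /=.
  by move=> cx [j _] [] [] /=; rewrite /preimage/= cx; tauto.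
move=> nx; apply: sepB => j; split=> h; apply: contrapT => nh; apply: nx; exists j => //.
  by right; split.
by left; split=> // -[].
Qed.

Definition fix_pact c : borel_set X := exist _ _ (measurable_pact_fix c).

(** Off its fixed-point set, [c] moves points across one of countably many
    sets [B j], and these sets detect that the model permutation of [c] moves
    the corresponding indices. *)
Lemma model_fix_sub c : ae R U (fun k i => s c k i = i -> i \in cset (fix_pact c) k).
Proof.
pose C j : set X := B j `+` (setT `&` a c @^-1` B j).
have mC j : measurable (C j) by apply: measurableY => //; exact: pact_borel.
pose D N : borel_set X := exist _ (tail C N) (measurable_tail N mC).
pose bB j : borel_set X := exist _ (B j) (mB j).
have key N : ae R U (fun k i => (s c k i = i /\ i \notin cset (fix_pact c) k) ->
    i \in cset (D N) k).
  pose F (j : bool + bool * 'I_N) := match j with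
    | inl true => fix_pact c | inl false => D N
    | inr (true, j) => bB j | inr (false, j) => preset c (bB j) end.
  apply: aeS2 (realize_sets F)
    (ae_fin (fun j : 'I_N => cset_preset c (bB j))) => k i [x hx] hs [ci /negP nfix].
  apply: contrapT => /negP nD; apply: nfix; apply/(hx (inl true)) => /=.
  apply: contrapT => ncx.
  have [j _ Cx] : (\bigcup_j C j) x.
    apply: contrapT => nC; apply: ncx; apply: sepB => j.
    split=> h; apply: contrapT => nh; apply: nC; exists j => //.
      by right; split.
    by left; split=> // -[].
  have [[j' /= j'N Cx']|nC] := pselect ((\bigcup_(j in `I_N) C j) x); last first.
    move/negP: nD; apply; apply/(hx (inl false)) => /=.
    by split=> //; exists j.
  have h1 : (i \in cset (bB j') k) <-> B j' x := hx (inr (true, Ordinal j'N)).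
  have h2 : (i \in cset (preset c (bB j')) k) <-> (setT `&` a c @^-1` B j') x :=
    hx (inr (false, Ordinal j'N)).
  have h3 := hs (Ordinal j'N); rewrite ci /= in h3; rewrite -h3 h1 in h2.
  by move: Cx' => [] [] b1 nb; apply: nb; apply/h2.
have [v hv] := ultra_tends R n0 (fun k i => s c k i = i /\ i \notin cset (fix_pact c) k).
have vN N : v <= mass mu (tail C N) by exact: tends_le (key N) hv (model_mass model (D N)).
have v0 : v = 0.
  apply/eqP; rewrite eq_le; have /andP[-> _] : 0 <= v <= 1 by exact: (tends_bounds n0 hv).
  rewrite andbT; apply: (ler_cvg_to (@cvg_cst _ _ _ _ _) (mass_tail mu mC)).
  by apply: nearW => N; exact: vN.
move: hv; rewrite v0 => /tends0_ae; apply: aeS => k i h ci.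
by apply: contrapT => /negP nfix; apply: h.
Qed.

End Realization.

End CovariantModel.

Arguments model_mass {R d X mu G a U n s cset} _ _.

(** * Local statistics of a model and soficity *)

Section SoficFromModel.
Variables (R : realType) (d : measure_display) (X : measurableType d).
Variable mu : probability X R.
Variables (G : groupType) (a : pmp_action G mu).
Variables (U : set_system nat) (n : nat -> nat).
Context {UU : UltraFilter U}.
Hypothesis n0 : forall k, (0 < n k)%N.
Variables (s : G -> forall k, 'S_(n k)) (cset : borel_set X -> forall k, {set 'I_(n k)}).
Hypothesis model : covariant_model a U s cset.
Variable B : nat -> set X.
Hypothesis mB : forall j, measurable (B j).
Hypothesis sepB : forall x y, (forall j, B j x <-> B j y) -> x = y.
Hypothesis model_tr : forall c, tends U (fun k i => s c k i = i) (pact_tr a c).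

Let sepX : countably_separated X.
Proof. by exists B. Qed.

Local Notation fixp c := (fix_pact a mB sepB c).

(** Preservation of the trace turns the inclusion of fixed points into an
    equality. *)
Lemma model_fix c : ae R U (fun k i => s c k i = i <-> i \in cset (fixp c) k).
Proof.
have htr : tends U (fun k i => s c k i = i) (mass mu (sval (fixp c))).
  exact: (@model_tr c).
exact: (ae_sub_eq n0 (model_fix_sub n0 model mB sepB c) htr (model_mass model (fixp c))).
Qed.

(** Membership of a translate of an index in the image of a set, and coincidence
    of two translates, are membership properties of the index itself, for
    preimages and for fixed-point sets, so that [realize_sets] applies. *)
Lemma realize_action (I J : finType) (F : I -> borel_set X) (c : J -> G) :
  ae R U (fun k i => exists x,
    (forall j l, s (c j) k i \in cset (F l) k <-> sval (F l) (a (c j) x)) /\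
    (forall j j', s (c j) k i = s (c j') k i <-> a (c j) x = a (c j') x)).
Proof.
pose H (t : J * I + J * J) := match t with
  | inl (j, l) => preset a (c j) (F l)
  | inr (j, j') => fixp ((c j')^-1 * c j)%g end.
have h1 := fun t : J * I => cset_preset model (c t.1) (F t.2).
have h2 := fun t : J * J => model_fix ((c t.2)^-1 * c t.1)%g.
have h3 := fun t : J * J => model_mul model (c t.2) ((c t.2)^-1 * c t.1)%g.
apply: aeS2 (realize_sets n0 model H)
  (aeI (ae_fin h1) (aeI (ae_fin h2) (ae_fin h3))) => k i [x hx] [e1 [e2 e3]].
exists x; split=> [j l|j j'].
  rewrite (e1 (j, l)) (hx (inl (j, l))) /=.
  by split=> [[]|].
have := hx (inr (j, j')); rewrite -(e2 (j, j')) /= => {}hx.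
have := e3 (j, j'); rewrite /= mulgA mulgV mul1g => ->.
split=> [/perm_inj/hx fx|xx].
  by rewrite -[in RHS]fx -pactM mulgA mulgV mul1g.
congr (s _ _ _); apply/hx; rewrite pactM xx -pactM mulVg pact1//.
Qed.

Variable E : cber X.
Hypothesis pmpE : measure_preserving mu E.
Hypothesis aE : pact_induces a E.
Variable e : nat -> G.
Hypothesis eG : forall c, exists j, e j = c.

Definition piece_set c (g : fsgB E) : borel_set X :=
  exist _ (piece a c g) (measurable_piece sepX aE c g).

(** The model of [g] before injectivity is enforced.  The choice among overlapping
    pieces is harmless: almost everywhere, they prescribe the same value. *)
Definition glue m k (g : fsgB E) (i : 'I_(n k)) : option 'I_(n k) :=
  omap (fun j : 'I_m => s (e j) k i) [pick j : 'I_m | i \in cset (piece_set (e j) g) k].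

Lemma glue_some m k (g : fsgB E) (i y : 'I_(n k)) : glue m g i = Some y ->
  exists2 j : 'I_m, i \in cset (piece_set (e j) g) k & y = s (e j) k i.
Proof. by rewrite /glue; case: pickP => //= j ij [<-]; exists j. Qed.

Lemma glue_none m k (g : fsgB E) (i : 'I_(n k)) : glue m g i = None ->
  forall j : 'I_m, i \notin cset (piece_set (e j) g) k.
Proof. by rewrite /glue; case: pickP => //= h _ j; rewrite h. Qed.

(** A model must be a partial bijection; by [gluedE], discarding the indices where
    [glue] is not injective costs almost nothing. *)
Definition glue_inj_fun m k (g : fsgB E) : {ffun 'I_(n k) -> option 'I_(n k)} :=
  [ffun i => if `[< forall i', glue m g i' = glue m g i -> i' = i >]
             then glue m g i else None].

Lemma glue_inj_funP m k (g : fsgB E) : pinjective (glue_inj_fun m k g).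
Proof.
move=> x y z; rewrite !ffunE; case: asboolP => // hx xz; case: asboolP => // hy yz.
by apply: hy; rewrite xz yz.
Qed.

Definition glued m k (g : fsgB E) : fsgn (n k) := Fsgn (@glue_inj_funP m k g).

(** If [e j] and [e l] send two indices [i] and [i'] to the same place, then
    [i'] is the image of [i] under a fixed group element, and the local picture
    of [i] at a point [x] of the space shows this element moving [x] to a point
    where [g] takes the value [g x].  Injectivity of [g] gives a fixed point. *)
Lemma gluedE m (g : fsgB E) : ae R U (fun k i => glued m k g i = glue m g i).
Proof.
pose c (t : unit + 'I_m + 'I_m * 'I_m) := match t with
  | inl (inl _) => 1%g | inl (inr j) => e j | inr (l, j) => ((e l)^-1 * e j)%g end.
have h1 := fun t : 'I_m * 'I_m => model_mul model (e t.1) ((e t.1)^-1 * e t.2)%g.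
apply: aeS2 (realize_action (fun j : 'I_m => piece_set (e j) g) c)
  (aeI (s_one model) (ae_fin h1)) => k i [x [xF xc]] [s1 sm].
rewrite ffunE; case: asboolP => // nii; apply/esym; apply: contrapT => gi.
apply: nii => i'; case gi': (glue m g i) gi => [y|]// _ gi''.
have [j ij yj] := glue_some gi'; have [l il yl] := glue_some gi''.
have i'E : i' = s ((e l)^-1 * e j)%g k i.
  apply: (@perm_inj _ (s (e l) k)); rewrite -yl yj.
  by have := sm (l, j); rewrite /= mulgA mulgV mul1g.
have pj : g x = Some (a (e j) x).
  have := xF (inl (inl tt)) j; rewrite /= s1 pact1 => h; exact/h.
have pl : g (a ((e l)^-1 * e j)%g x) = Some (a (e j) x).
  have := xF (inr (l, j)) l; rewrite /= -i'E => -[/(_ il) + _].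
  by rewrite /piece /= -pactM mulgA mulgV mul1g.
have := xc (inr (l, j)) (inl (inl tt)); rewrite /= s1 -i'E pact1 => h; apply/h.
exact: fsgB_inj pl pj.
Qed.

(** A property of level [m] that holds almost everywhere off the image of a set
    of mass tending to 0 has small failure frequency for [m] large and then [k]
    large. *)
Lemma eventually_freq (Q : nat -> forall k, 'I_(n k) -> Prop) (D : nat -> borel_set X) :
  mass mu (sval (D m)) @[m --> \oo] --> 0 ->
  (forall m, ae R U (fun k i => i \notin cset (D m) k -> Q m k i)) ->
  forall r, 0 < r ->
  \forall m \near \oo, \forall k \near U, freq R (fun i => ~ Q m k i) < r.
Proof.
move=> D0 DQ r r0; have /cvgr_lt/(_ r r0) := D0.
apply: filterS => m Dm.
have : freq R (fun i => i \in cset (D m) k) +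
    freq R (fun i => ~ (i \notin cset (D m) k -> Q m k i)) @[k --> U]
    --> mass mu (sval (D m)) + 0.
  by apply: cvgD; [exact: (model_mass model (D m))|exact: DQ].
rewrite addr0 => /cvgr_lt/(_ r Dm); apply: filterS => k; apply: le_lt_trans.
apply: freq_le2 => i nQ; have [iD|iD] := boolP (i \in cset (D m) k); first by left.
by right=> /(_ isT).
Qed.

(** At a point outside the set [D], all values of [g], [h] and [p] involved are
    given by the first [m] group elements, and the identity to be proved is an
    identity between actions of group elements on that point.  It is transferred
    to the indices whose local picture is that point. *)
Lemma glued_mul (g h p : fsgB E) : dmu mu p (fsgB_mul g h) = 0 ->
  forall r, 0 < r -> \forall m \near \oo, \forall k \near U,
    freq R (fun i => ~ (glued m k p i = pcomp (glued m k g) (glued m k h) i)) < r.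
Proof.
move=> pgh; pose D' m := neqset p (fsgB_mul g h) `|` remainder a e h m
  `|` (ppreimage h (remainder a e g m) `|` remainder a e p m).
have mN := measurable_neqset sepX p (fsgB_mul g h).
have mR f m := measurable_remainder sepX aE eG f m.
have mP m : measurable (ppreimage h (remainder a e g m)) by exact: fsgB_preimage.
have mD m : measurable (D' m) by do 2 (apply: measurableU => //); exact: measurableU.
pose D m : borel_set X := exist _ (D' m) (mD m).
apply: (eventually_freq (D := D)).
  have h0 : mass mu (remainder a e h m) + (mass mu (remainder a e g m) +
      mass mu (remainder a e p m)) @[m --> \oo] --> 0.
    rewrite -[X in _ --> X](addr0 0) -[X in _ --> _ + X](addr0 0).
    by apply: cvgD; [|apply: cvgD]; exact: (mass_remainder sepX aE eG).
  apply: (squeeze_cvgr _ (@cvg_cst _ _ _ _ _) h0); apply: nearW => m.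
  rewrite mass_ge0 /=; apply: le_trans (massU_le mu _ _) _ => //;
    [exact: measurableU|exact: measurableU|].
  apply: lerD.
    by apply: le_trans (massU_le mu _ _) _ => //; rewrite -dmuE// pgh add0r.
  apply: le_trans (massU_le mu _ _) _ => //; apply: lerD => //.
  exact: mass_ppreimage.
move=> m; pose F (t : 'I_m + 'I_m + 'I_m + unit) := match t with
  | inl (inl (inl j)) => piece_set (e j) g | inl (inl (inr j)) => piece_set (e j) h
  | inl (inr j) => piece_set (e j) p | inr _ => D m end.
pose c (t : unit + 'I_m + 'I_m * 'I_m) := match t with
  | inl (inl _) => 1%g | inl (inr j) => e j | inr (l, j) => (e l * e j)%g end.
have h1 := fun t : 'I_m * 'I_m => model_mul model (e t.1) (e t.2).
have h2 := fun j : 'I_m => ae_perm (s (e j)) (gluedE m g).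
apply: aeS2 (aeI (realize_action F c) (aeI (s_one model) (ae_fin h1)))
  (aeI (ae_fin h2) (aeI (gluedE m h) (gluedE m p))).
move=> k i [[x [xF xc]] [s1 sm]] [gE [hE pE]] niD.
have at1 t : i \in cset (F t) k <-> sval (F t) x.
  by have := xF (inl (inl tt)) t; rewrite /= s1 pact1.
have {niD} xD : ~ D' m x by move=> xD; move/negP: niD; apply; apply/(at1 (inr tt)).
have [[xN xh] [xg xp]] : (~ neqset p (fsgB_mul g h) x /\ ~ remainder a e h m x) /\
    (~ ppreimage h (remainder a e g m) x /\ ~ remainder a e p m x).
  by split; split=> xx; apply: xD; [left; left|left; right|right; left|right; right].
have {xN} pgx : p x = pcomp g h x by exact: contrapT.
have p_none : p x = None -> glue m p i = None.
  move=> px; case gp: (glue m p i) => [y|]//; have [j ij _] := glue_some gp.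
  by have /(at1 (inl (inr j))) := ij; rewrite /= /piece/= px.
have p_some b : p x = Some (a (c b) x) -> glue m p i = Some (s (c b) k i).
  move=> px; case gp: (glue m p i) => [y|].
    have [j ij ->] := glue_some gp; congr Some; apply/(xc (inl (inr j)) b).
    by have /(at1 (inl (inr j))) := ij; rewrite /= /piece/= px => -[].
  have [j jm xj] := not_remainder px xp.
  have /negP[] := glue_none gp (Ordinal jm); apply/(at1 (inl (inr (Ordinal jm)))).
  by rewrite /= /piece/= px xj.
rewrite pE /pcomp hE; case gh: (glue m h i) => [y|] /=; last first.
  apply: p_none; rewrite pgx /pcomp; case hx: (h x) => [z|]//=.
  have [j jm zj] := not_remainder hx xh.
  have /negP[] := glue_none gh (Ordinal jm); apply/(at1 (inl (inl (inr (Ordinal jm))))).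
  by rewrite /= /piece/= hx zj.
have [j ij ->] := glue_some gh; rewrite gE.
have hx : h x = Some (a (e j) x) by exact/(at1 (inl (inl (inr j)))).
have xg' : ~ remainder a e g m (a (e j) x).
  by move=> r; apply: xg; exists (a (e j) x).
have atj (l : 'I_m) : s (e j) k i \in cset (piece_set (e l) g) k <-> piece a (e l) g (a (e j) x).
  exact: (xF (inl (inr j)) (inl (inl (inl l)))).
case gg: (glue m g (s (e j) k i)) => [z|].
  have [l il ->] := glue_some gg.
  have /= := sm (l, j) => <-; apply: (p_some (inr (l, j))).
  by rewrite pgx /pcomp hx /= ((atj l).1 il) pactM.
apply: p_none; rewrite pgx /pcomp hx /=; case gx: (g (a (e j) x)) => [z|]//.
have [l lm zl] := not_remainder gx xg'.
have /negP[] := glue_none gg (Ordinal lm); apply/(atj (Ordinal lm)).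
by rewrite /piece/= gx zl.
Qed.

Definition fixb (g : fsgB E) : borel_set X := exist _ (fixset g) (measurable_fixset sepX g).

Lemma glued_fix (g : fsgB E) r : 0 < r -> \forall m \near \oo, \forall k \near U,
  freq R (fun i => ~ (glued m k g i = Some i <-> i \in cset (fixb g) k)) < r.
Proof.
pose D m : borel_set X := exist _ (remainder a e g m) (measurable_remainder sepX aE eG g m).
move: r; apply: (eventually_freq (D := D)); first exact: mass_remainder.
move=> m; pose F (t : 'I_m + bool) := match t with
  | inl j => piece_set (e j) g | inr true => fixb g | inr false => D m end.
pose c (t : unit + 'I_m) := match t with inl _ => 1%g | inr j => e j end.
apply: aeS2 (realize_action F c) (aeI (s_one model) (gluedE m g)).
move=> k i [x [xF xc]] [s1 gE] niD.
have at1 t : i \in cset (F t) k <-> sval (F t) x.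
  by have := xF (inl tt) t; rewrite /= s1 pact1.
have xD : ~ remainder a e g m x.
  by move=> xD; move/negP: niD; apply; apply/(at1 (inr false)).
have fixE (j : 'I_m) : s (e j) k i = i <-> a (e j) x = x.
  by have := xc (inr j) (inl tt); rewrite /= s1 pact1.
rewrite gE; split=> [/glue_some[j ij] ji|ifix].
  apply/(at1 (inr true)); rewrite /= /fixset/=.
  have -> : g x = Some (a (e j) x) by exact/(at1 (inl j)).
  by congr Some; apply/fixE.
have gx : g x = Some x by exact/(at1 (inr true)).
case gi: (glue m g i) => [y|].
  have [j ij ->] := glue_some gi; congr Some; apply/fixE.
  have : g x = Some (a (e j) x) by exact/(at1 (inl j)).
  by rewrite gx => -[].
have [j jm xj] := not_remainder gx xD.
have /negP[] := glue_none gi (Ordinal jm); apply/(at1 (inl (Ordinal jm))).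
by rewrite /= /piece/= gx -xj.
Qed.

Lemma glued_id (g : fsgB E) r : dmu mu g (fsgB_id E) = 0 -> 0 < r ->
  \forall m \near \oo, \forall k \near U, freq R (fun i => ~ (glued m k g i = Some i)) < r.
Proof.
move=> gid r0; have r20 : 0 < r / 2 by rewrite divr_gt0.
have full : ae R U (fun k i => i \in cset (fixb g) k).
  apply: (cset_full n0 model) => /=.
  have := mass_fixset_le mu sepX (fsgB_id E) g; rewrite dmuC// gid addr0.
  rewrite (_ : fixset (fsgB_id E) = setT) ?massT; last by apply/seteqP; split.
  move=> h; apply/eqP; rewrite eq_le h andbT -[leRHS](massT mu).
  by apply: mass_le => //; exact: measurable_fixset.
have hfull : \forall k \near U, freq R (fun i => ~ i \in cset (fixb g) k) < r / 2.
  by have /cvgr_lt := full; apply.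
have := glued_fix g r20; apply: filterS => m hm.
apply: filterS2 hfull hm => k h1 h2; rewrite [ltRHS]splitr.
apply: le_lt_trans (ltrD h1 h2); apply: freq_le2 => i ng.
have [ifix|nfix] := pselect (i \in cset (fixb g) k); last by left.
by right => -[_ /(_ ifix)].
Qed.

Lemma glued_empty (g : fsgB E) r : dmu mu g (fsgB_empty E) = 0 -> 0 < r ->
  \forall m \near \oo, \forall k \near U, freq R (fun i => ~ (glued m k g i = None)) < r.
Proof.
move=> g0 r0; apply: nearW => m.
have nul (j : 'I_m) : ae R U (fun k i => i \notin cset (piece_set (e j) g) k).
  apply: (cset_null model) => /=; apply/eqP; rewrite eq_le mass_ge0 andbT.
  rewrite -g0 dmuE//; apply: mass_le.
  - exact: measurable_piece.
  - exact: measurable_neqset.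
  - by move=> x; rewrite /piece /neqset/= => ->.
suff h : ae R U (fun k i => glued m k g i = None).
  by have /cvgr_lt := h; apply.
apply: aeS2 (gluedE m g) (ae_fin nul) => k i -> ni.
case gi: (glue m g i) => [y|]//; have [j ij _] := glue_some gi.
by have := ni j; rewrite ij.
Qed.

Lemma freq_comp_fsgn k (t : fsgn k) (P : 'I_k -> Prop) :
  freq R (fun i => exists2 j, t i = Some j & P j) <= freq R P.
Proof.
have [p hp] := fsgn_extend t; rewrite -(freq_comp_perm R p P).
by apply: freq_le => i [j /hp <-].
Qed.

(** Soficity prescribes the images of the identity and of the empty map exactly,
    while [glued] takes the right values only up to a small error. *)
Definition sofic_map m k (q : full_semigroup mu E) : fsgn (n k) :=
  if `[< q = fsg_id mu E >] then fsgn_id (n k)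
  else if `[< q = fsg_empty mu E >] then fsgn_empty (n k)
  else glued m k (mrepr q).

Lemma sofic_map_glued q r : 0 < r -> \forall m \near \oo, \forall k \near U,
  freq R (fun i => ~ (sofic_map m k q i = glued m k (mrepr q) i)) < r.
Proof.
move=> r0; have [qid|nid] := pselect (q = fsg_id mu E).
  have h := glued_id (mrepr_dmu mu sepX (fsgB_id E)) r0.
  apply: filterS h => m; apply: filterS => k; apply: le_lt_trans.
  apply: freq_le => i; rewrite /sofic_map asboolT// qid => nq gi; apply: nq.
  by rewrite gi ffunE perm1.
have [q0|ne] := pselect (q = fsg_empty mu E).
  have h := glued_empty (mrepr_dmu mu sepX (fsgB_empty E)) r0.
  apply: filterS h => m; apply: filterS => k; apply: le_lt_trans.
  apply: freq_le => i; rewrite /sofic_map asboolF// asboolT// q0 => nq gi; apply: nq.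
  by rewrite gi ffunE.
apply: nearW => m; apply: nearW => k; rewrite [ltLHS](_ : _ = 0)//.
rewrite -(freq_False R (n k)); apply: eq_freq => i.
by rewrite /sofic_map asboolF// asboolF//; split=> //; apply.
Qed.

(** Combining the finitely many estimates asked by soficity is taking an
    intersection in the iterated filter: [m] large, then [k] large. *)
Let often : set_system (nat * nat) :=
  [set P | \forall m \near \oo, \forall k \near U, P (m, k)].

Let often_filter : ProperFilter often.
Proof.
apply: Build_ProperFilter.
  move=> h; have [m hm] := @filter_ex _ (\oo : set_system nat) _ _ h.
  by have [k] := @filter_ex _ U _ _ hm.
split.
- by apply: nearW => m; exact: nearW.
- move=> P Q hP hQ.
  by apply: (@filterS2 _ (\oo : set_system nat) _ _ _ _ _ hP hQ) => m; exact: (@filterI _ U).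
- move=> P Q PQ hP; apply: (@filterS _ (\oo : set_system nat) _ _ _ _ hP) => m.
  by apply: (@filterS _ U) => k; exact: PQ.
Qed.

Lemma filter_finite_set (T I : Type) (F : set_system T) (K : set I) (P : I -> set T) :
  Filter F -> finite_set K -> (forall i, K i -> F (P i)) ->
  F [set x | forall i, K i -> P i x].
Proof.
move=> FF /(@finite_seqP {classic I})[l ->] h.
have {h} : forall i : {classic I}, i \in l -> F (P i) by move=> i il; exact: h.
elim: l => [|i l ih] h; first by apply: filterS filterT => x _ i.
have h1 := h i (mem_head _ _).
have h2 := ih (fun j jl => h j (mem_behead (s := i :: l) jl)).
apply: filterS2 h1 h2 => x Pi Pl j /=.
by rewrite inE => /predU1P[->//|/Pl].
Qed.

Lemma sofic_of_model : sofic mu E.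
Proof.
move=> K r finK r0; have r4 : 0 < r / 4 by rewrite divr_gt0.
have r5 : 0 < r / 5 by rewrite divr_gt0.
have near_mul q q' : often [set p |
    dcount R (sofic_map p.1 p.2 (fsg_mul q q'))
      (fsgn_mul (sofic_map p.1 p.2 q) (sofic_map p.1 p.2 q')) < r].
  have h1 := sofic_map_glued (fsg_mul q q') r5.
  have h2 := sofic_map_glued q r5; have h3 := sofic_map_glued q' r5.
  have h4 := glued_mul (mrepr_dmu mu sepX (fsgB_mul (mrepr q) (mrepr q'))) r5.
  apply: filterS2 (filterI h1 h2) (filterI h3 h4) => m [k1 k2] [k3 k4].
  apply: filterS2 (filterI k1 k2) (filterI k3 k4) => k [f1 f2] [f3 f4].
  rewrite /= dcountE.
  have : freq R (fun i => sofic_map m k (fsg_mul q q') i <>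
      fsgn_mul (sofic_map m k q) (sofic_map m k q') i) <=
    (freq R (fun i => ~ (sofic_map m k (fsg_mul q q') i = glued m k (mrepr (fsg_mul q q')) i)) +
     freq R (fun i => ~ (glued m k (mrepr (fsg_mul q q')) i =
       pcomp (glued m k (mrepr q)) (glued m k (mrepr q')) i))) +
    (freq R (fun i => ~ (sofic_map m k q' i = glued m k (mrepr q') i)) +
     freq R (fun i => ~ (sofic_map m k q i = glued m k (mrepr q) i))).
    rewrite -[X in _ <= _ + (_ + X)]addr0.
    apply: le_trans (lerD (freqU_le _ _ _) (lerD (lexx _) _)); last first.
      rewrite addr0.
      exact: (freq_comp_fsgn (glued m k (mrepr q'))
        (fun i => ~ (sofic_map m k q i = glued m k (mrepr q) i))).
    apply: le_trans (lerD (lexx _) (freqU_le _ _ _)).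
    apply: freq_le2 => i ne; apply: contrapT => /not_orP[/not_orP[/contrapT e1 /contrapT e2]].
    move=> /not_orP[/contrapT e3 e4]; apply: ne.
    rewrite e1 e2 ffunE /pcomp e3; case gi: (glued m k (mrepr q') i) => [j|]//=.
    by apply: contrapT => nj; apply: e4; exists j => //; exact: nesym.
  move=> hle; apply: le_lt_trans hle _; lra.
have near_tr q : often [set p |
    `|fsg_tr q - fsgn_tr R (sofic_map p.1 p.2 q)| < r].
  have h1 := sofic_map_glued q r4; have h2 := glued_fix (mrepr q) r4.
  apply: filterS2 h1 h2 => m k1 k2.
  have k3 : \forall k \near U, `|mass mu (fixset (mrepr q)) -
      freq R (fun i => i \in cset (fixb (mrepr q)) k)| < r / 4.
    by have /cvgrPdist_lt := model_mass model (fixb (mrepr q)); apply.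
  apply: filterS3 k1 k2 k3 => k f1 f2 f3 /=; rewrite fsgn_trE.
  rewrite /fsg_tr -/(mass mu _) -/(fixset _).
  have le1 : freq R (fun i => sofic_map m k q i = Some i) <=
      freq R (fun i => i \in cset (fixb (mrepr q)) k) +
      (freq R (fun i => ~ (sofic_map m k q i = glued m k (mrepr q) i)) +
       freq R (fun i => ~ (glued m k (mrepr q) i = Some i <-> i \in cset (fixb (mrepr q)) k))).
    apply: le_trans (lerD (lexx _) (freqU_le _ _ _)); apply: freq_le2 => i si.
    apply: contrapT => /not_orP[ni /not_orP[/contrapT e1 /contrapT e2]].
    by apply: ni; apply/e2; rewrite -e1.
  have le2 : freq R (fun i => i \in cset (fixb (mrepr q)) k) <=
      freq R (fun i => sofic_map m k q i = Some i) +
      (freq R (fun i => ~ (sofic_map m k q i = glued m k (mrepr q) i)) +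
       freq R (fun i => ~ (glued m k (mrepr q) i = Some i <-> i \in cset (fixb (mrepr q)) k))).
    apply: le_trans (lerD (lexx _) (freqU_le _ _ _)); apply: freq_le2 => i si.
    apply: contrapT => /not_orP[ni /not_orP[/contrapT e1 /contrapT e2]].
    by apply: ni; rewrite e1; apply/e2.
  move: f3; rewrite !ltr_norml => /andP[f3 f3']; apply/andP; split; lra.
have {near_mul} hm := filter_finite_set often_filter (finite_setX finK finK)
  (fun p _ => near_mul p.1 p.2).
have {near_tr} ht := filter_finite_set often_filter finK (fun q _ => near_tr q).
have [[m k] [hmk htk]] := @filter_ex _ often often_filter _
  (@filterI _ often (@filter_filter _ _ often_filter) _ _ hm ht).
exists (n k), (sofic_map m k); split=> //.
- split; first by rewrite /sofic_map asboolT.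
  rewrite /sofic_map asboolF ?asboolT// => /(mcls_dmu mu sepX).
  rewrite dmuE// (_ : neqset _ _ = setT) ?massT; first by move/eqP; rewrite oner_eq0.
  by apply/seteqP; split.
- by move=> g h Kg Kh; apply: (hmk (g, h)).
Qed.

End SoficFromModel.

(** * The equivalences *)

Lemma exists_free_ultrafilter : exists2 U : set_system nat, free_ultrafilter U &
  forall P : nat -> Prop, (\forall k \near \oo, P k) -> U P.
Proof.
have [U [UU subU]] := ultraFilterLemma (F := \oo : set_system nat) _.
exists U; last by move=> P; exact: subU.
split=> // m Um.
have UC : U (~` [set m]) by apply: subU; exists m.+1 => // k /= mk km; rewrite km ltnn in mk.
have U0 : U set0 by rewrite -(setICr [set m]); exact: filterI.
by have [x []] := @filter_ex _ U _ _ U0.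
Qed.

Section Conditions.
Variables (R : realType) (d : measure_display) (X : measurableType d).
Variable mu : probability X R.
Hypothesis stdX : standard_borel R X.
Variable E : cber X.
Hypothesis pmpE : measure_preserving mu E.
Variable G : groupType.
Hypothesis countG : countable [set: G].
Variable a : pmp_action G mu.
Hypothesis aE : pact_induces a E.

Definition full_group_pair : Prop :=
  exists (U : set_system nat) (n : nat -> nat)
      (theta : full_group mu E -> uperm R U n) (phi : MAlg mu -> uMAlg R U n),
    [/\ free_ultrafilter U, forall k, (0 < n k)%N,
        full_group_embedding theta, MAlg_embedding phi
      & covariant (@fg_act R d X mu E) (@uperm_act R U n) theta phi].

Definition group_pair_at (U : set_system nat) (n : nat -> nat)
    (theta : G -> uperm R U n) (phi : MAlg mu -> uMAlg R U n) : Prop :=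
  [/\ free_ultrafilter U, forall k, (0 < n k)%N, uperm_hom theta, MAlg_embedding phi
    & covariant (pact_MAlg a) (@uperm_act R U n) theta phi].

Let sepX : countably_separated X.
Proof. by have [B [mB sB _]] := standard_borel_basis mu stdX; exists B. Qed.

Lemma countable_enum : exists e : nat -> G, forall c, exists j, e j = c.
Proof.
have /countable_injP[f finj] := countG.
exists (fun j => if pselect (exists c, f c = j) is left h then sval (cid h) else 1%g).
move=> c; exists (f c); case: pselect => [h|[]]; last by exists c.
by apply: finj; rewrite ?inE//; exact: (svalP (cid h)).
Qed.

Lemma sofic_full_group_pair : sofic mu E -> full_group_pair.
Proof.
move=> sof; have [B [mB _ densB]] := standard_borel_basis mu stdX.
have [e eG] := countable_enum.
have [D densD] := fsgB_separable sepX aE eG mB densB.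
have [n [Pi sofPi]] := sofic_sequenceP sepX pmpE densD sof.
have [U freeU Uoo] := exists_free_ultrafilter.
have UU : UltraFilter U by case: freeU.
have n0 : forall k, (0 < n k)%N by case: sofPi.
exists U, n, (theta_sofic Pi U), (phi_sofic Pi U); split=> //.
- exact: theta_sofic_embedding.
- exact: phi_sofic_embedding.
- exact: sofic_covariant.
Qed.

Lemma full_group_pair_group_pair : full_group_pair ->
  exists U n theta phi, @group_pair_at U n theta phi /\
    forall c, uperm_tr (theta c) = pact_tr a c.
Proof.
move=> [U [n [theta [phi [freeU n0 thE phE cov]]]]].
have UU : UltraFilter U by case: freeU.
exists U, n, (theta \o fg_pact aE), phi; split; last by move=> c; exact: fg_pact_tr.
split=> //; first exact: fg_pact_hom.
exact: fg_pact_covariant.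
Qed.

Lemma group_pair_sofic U n theta phi : @group_pair_at U n theta phi ->
  (forall c, uperm_tr (theta c) = pact_tr a c) -> sofic mu E.
Proof.
move=> [freeU n0 hom emb cov] tr.
have UU : UltraFilter U by case: freeU.
have [B [mB sB _]] := standard_borel_basis mu stdX.
have [e eG] := countable_enum.
apply: (sofic_of_model n0 (embedding_model n0 hom emb cov) mB sB _ pmpE aE eG) => c.
by rewrite -tr; exact: tends_uperm_tr.
Qed.

(** For a free action the fixed points of a nontrivial element form a null set,
    which already contains, on the side of the model, all indices fixed by its
    permutation; so both traces vanish. *)
Lemma group_pair_free_tr U n theta phi : @group_pair_at U n theta phi ->
  pact_free a -> forall c, uperm_tr (theta c) = pact_tr a c.
Proof.
move=> [freeU n0 hom emb cov] free c.
have UU : UltraFilter U by case: freeU.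
have [B [mB sB _]] := standard_borel_basis mu stdX.
have model : covariant_model a U (fun c => mrepr (theta c))
    (fun A => mrepr (phi (mcls (dMAlg mu) A))) by exact: embedding_model.
apply: (tends_unique (tends_uperm_tr n0 (p := theta c))).
have [->|c1] := eqVneq c 1%g.
  rewrite /pact_tr -/(mass mu _) (_ : [set x | _] = setT); last first.
    by apply/seteqP; split=> // x _ /=; exact: pact1.
  rewrite massT; apply/(tends1_ae R n0).
  exact: (s_one model).
have fix0 : mass mu [set x | a c x = x] = 0.
  apply/eqP; rewrite /mass; suff -> : mu [set x | a c x = x] = 0%E by [].
  have [N [mN N0 subN]] := free.
  apply: (subset_measure0 (measurable_pact_fix a mB sB c) mN _ N0).
  by move=> x cx; apply: subN => /(_ c cx) cE; rewrite cE eqxx in c1.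
rewrite /pact_tr -/(mass mu _) fix0; apply/tends0_ae.
apply: aeS2 (model_fix_sub n0 model mB sB c)
  (cset_null model (A := fix_pact a mB sB c) fix0) => k i h /negP ni /h.
by [].
Qed.

End Conditions.
Theorem proposition2p4 (R : realType) (d : measure_display)
    (X : measurableType d) (mu : probability X R)
    (stdX : standard_borel R X)
    (E : cber X) (pmpE : measure_preserving mu E)
    (G : groupType) (countG : countable [set: G])
    (a : pmp_action G mu) (aE : pact_induces a E) :
  [/\ sofic mu E <->
      (exists (U : set_system nat) (n : nat -> nat)
          (theta : full_group mu E -> uperm R U n)
          (phi : MAlg mu -> uMAlg R U n),
        [/\ free_ultrafilter U, forall k, (0 < n k)%N,
            full_group_embedding theta, MAlg_embedding phi
          & covariant (@fg_act R d X mu E) (@uperm_act R U n) theta phi]),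
      sofic mu E <->
      (exists (U : set_system nat) (n : nat -> nat)
          (theta : G -> uperm R U n) (phi : MAlg mu -> uMAlg R U n),
        [/\ free_ultrafilter U /\ (forall k, (0 < n k)%N),
            uperm_hom theta,
            forall g, uperm_tr (theta g) = pact_tr a g,
            MAlg_embedding phi
          & covariant (pact_MAlg a) (@uperm_act R U n) theta phi])
    & pact_free a ->
      (sofic mu E <->
      (exists (U : set_system nat) (n : nat -> nat)
          (theta : G -> uperm R U n) (phi : MAlg mu -> uMAlg R U n),
        [/\ free_ultrafilter U, forall k, (0 < n k)%N,
            uperm_hom theta, MAlg_embedding phi
          & covariant (pact_MAlg a) (@uperm_act R U n) theta phi]))].
Proof.
have pairs : sofic mu E -> exists U n theta phi, @group_pair_at R d X mu G a U n theta phi /\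
    forall c, uperm_tr (theta c) = pact_tr a c.
  by move=> sof; apply: (full_group_pair_group_pair stdX pmpE aE);
    exact: (sofic_full_group_pair stdX pmpE countG aE sof).
split.
- split=> [|pair]; first exact: (sofic_full_group_pair stdX pmpE countG aE).
  have [U [n [theta [phi [gp tr]]]]] := full_group_pair_group_pair stdX pmpE aE pair.
  exact: (group_pair_sofic stdX pmpE countG aE gp tr).
- split=> [/pairs[U [n [theta [phi [[freeU n0 hom emb cov] tr]]]]]|].
    by exists U, n, theta, phi.
  move=> [U [n [theta [phi [[freeU n0] hom tr emb cov]]]]].
  exact: (group_pair_sofic stdX pmpE countG aE (And5 freeU n0 hom emb cov) tr).
- move=> free; split=> [/pairs[U [n [theta [phi [gp _]]]]]|].
    by exists U, n, theta, phi.
  move=> [U [n [theta [phi gp]]]].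
  exact: (group_pair_sofic stdX pmpE countG aE gp (group_pair_free_tr stdX gp free)).
Qed.
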